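(* Let $K$ be a field, $S=K[x_1,\dots,x_n]$, and let $I\subset S$ be a monomial ideal of minimal intersection type which has a linear cover function. If $\mathcal{R}_s(I)$ satisfies the $x$-condition with respect to the monomial order $>$ on $T=S[y_1,\dots,y_m]$ defined in the context, then $I^{(k)}$ has linear quotients for all $k\ge1$. In particular, $I^{(k)}$ is componentwise linear for all $k\ge 1$.
   Context: **Minimal intersection type.** $I=\bigcap_{i=1}^rP_i^{k_i}$ with $r\ge1$, $k_i\ge1$, and $P_i$ monomial primes (generated by non-empty sets of variables) with $P_i\not\subseteq P_j$ for $i\neq j$. Set $F_i=\{j:x_j\in P_i\}$. **Symbolic powers.** $I^{(k)}=\bigcap_{P\in\mathrm{Ass}(I)}(I^kS_P\cap S)$, and $\mathcal{R}_s(I)=\bigoplus_{k\ge0}I^{(k)}t^k\subset S[t]$, which is known to be a finitely generated $S$-algebra. **Covers.** For $k\ge0$, a vector ${\bf a}\in\mathbb{Z}_{\ge0}^n$ is a $k$-cover if $\sum_{j\in F_i}a_j\ge kk_i$ for all $i$. A $k$-cover ${\bf a}$ is indecomposable if it cannot be written as ${\bf a}={\bf a}_1+{\bf a}_2$ with ${\bf a}_1,{\bf a}_2$ nonzero, ${\bf a}_j$ a $p_j$-cover ($p_j\geq 0$), and $k=p_1+p_2$. Write $|{\bf a}|=a_1+\dots+a_n$. The ideal $I$ has a *linear cover function* if there are integers $c,d\ge0$ such that $|{\bf a}|=ck+d$ for every $k\ge1$ and every indecomposable $k$-cover ${\bf a}$. **The presentation.** Let $w_1,\dots,w_m$ be the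 minimal monomial generators of $\mathcal{R}_s(I)$ as an $S$-algebra; these are the monomials ${\bf x^a}t^k$ with $k\ge1$ and ${\bf a}$ an indecomposable $k$-cover. They are labelled so that $w_1>\dots>w_m$, where $ut^p>vt^q$ iff $p>q$, or $p=q$ and $u>_{\mathrm{lex}}v$ (lexicographic order on $S$ with $x_1>\dots>x_n$). Let $T=S[y_1,\dots,y_m]$, $\varphi:T\to\mathcal{R}_s(I)$ the $S$-algebra map with $\varphi(y_i)=w_i$, and $J=\mathrm{Ker}\,\varphi$. **The order on $T$.** Let $>_{\mathrm{rlex}}$ be the (degree) reverse lexicographic order on $K[y_1,\dots,y_m]$ with $y_1>\dots>y_m$. For monomials $g,g'$ in the $y$'s and $f,f'$ in the $x$'s, put $gf>g'f'$ iff $g>_{\mathrm{rlex}}g'$, or $g=g'$ and $f>_{\mathrm{lex}}f'$. **$x$-condition.** $\mathcal{R}_s(I)$ satisfies the $x$-condition with respect to a monomial order on $T$ if every minimal monomial generator of the initial ideal $\mathrm{in}_<(J)$ has the form $vv'$ with $v\in S$ a monomial of degree at most one and $v'\in K[y_1,\dots,y_m]$ a monomial. **Linear quotients / componentwise linear.** A monomial ideal $L$ has linear quotients if its minimal monomial generators can be ordered $u_1,\dots,u_s$ so that $(u_1,\dots,u_{i-1}):(u_i)$ is generated by variables for $i=2,\dots,s$. A graded ideal $L$ is componentwise linear if for each $d$ the ideal $L_{\langle d\rangle}$ generated by all homogeneous elements of $L$ of degree $d$ has a linear resolution. *)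

(* Defs.v *)
From HB Require Import structures.
From mathcomp Require Import all_boot all_order all_algebra.
From mathcomp.multinomials Require Import mpoly.

Set Implicit Arguments.
Unset Strict Implicit.
Unset Printing Implicit Defensive.

Import GRing.Theory.
Local Open Scope ring_scope.

(* Ideals are Prop-valued predicates, compared pointwise. *)
Definition same_ideal (A : Type) (P Q : A -> Prop) : Prop :=
  forall f, P f <-> Q f.

Section Ideals.

Variable A : comNzRingType.
Implicit Types (G P L M : A -> Prop).

Definition ideal_gen G : A -> Prop := fun f =>
  exists2 s : seq (A * A), forall p, p \in s -> G p.2
                         & f = \sum_(p <- s) p.1 * p.2.

Definition ideal_pow L (k : nat) : A -> Prop :=
  ideal_gen (fun f => exists2 g : 'I_k -> A, forall i, L (g i)
                                           & f = \prod_(i < k) g i).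

Definition colon L M : A -> Prop := fun f => forall g, M g -> L (f * g).

Definition is_ideal P : Prop :=
  [/\ P 0, forall f g, P f -> P g -> P (f + g)
         & forall f g, P g -> P (f * g)].

Definition prime_ideal P : Prop :=
  [/\ is_ideal P, ~ P 1 & forall f g, P (f * g) -> P f \/ P g].

(* P is in Ass(L), i.e. P is a prime of the form Ann_(A/L) (f + L). *)
Definition assoc_prime L P : Prop :=
  prime_ideal P /\ exists f, forall g, P g <-> L (g * f).

(* The contraction L A_P :&: A of the extension of L to the localization. *)
Definition loc_contraction L P : A -> Prop := fun f =>
  exists2 s, ~ P s & L (s * f).

Definition symbolic_power L (k : nat) : A -> Prop := fun f =>
  forall P, assoc_prime L P -> loc_contraction (ideal_pow L k) P f.

(* Viewed inside A[t] = {poly A}. *)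
Definition symbolic_rees L : {poly A} -> Prop := fun p =>
  forall k, symbolic_power L k p`_k.

(* The A-subalgebra of A[t] generated by G. *)
Definition subalgebra (B : {poly A} -> Prop) : Prop :=
  [/\ forall c, B c%:P,
      forall f g, B f -> B g -> B (f + g)
    & forall f g, B f -> B g -> B (f * g)].

Definition algebra_gen (G : {poly A} -> Prop) : {poly A} -> Prop := fun p =>
  forall B, subalgebra B -> (forall g, G g -> B g) -> B p.

End Ideals.

(* Pure lexicographic order with the variable of index 0 largest. *)
Definition lex_gt n (u v : 'X_{1..n}) : bool :=
  [exists i : 'I_n, (v i < u i)%N && [forall j : 'I_n, (j < i)%N ==> (u j == v j)]].

(* Degree reverse lexicographic order with the variable of index 0 largest. *)
Definition rlex_gt n (u v : 'X_{1..n}) : bool :=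
  (mdeg v < mdeg u)%N ||
  ((mdeg u == mdeg v) &&
   [exists i : 'I_n, (u i < v i)%N &&
                     [forall j : 'I_n, (i < j)%N ==> (u j == v j)]]).

Section Monomial.

Variables (K : fieldType) (n : nat).
Local Notation S := {mpoly K[n]}.
Implicit Types (L : S -> Prop) (u : 'X_{1..n}).

Definition var_ideal (V : {set 'I_n}) : S -> Prop :=
  ideal_gen (fun f => exists2 j, j \in V & f = 'X_j).

Definition monomial_span (us : seq 'X_{1..n}) : S -> Prop :=
  ideal_gen (fun f => exists2 u, u \in us & f = 'X_[u]).

Definition min_mon_gen L u : Prop :=
  L 'X_[u] /\ forall v, L 'X_[v] -> (v <= u)%MM -> v = u.

Definition linear_quotients L : Prop :=
  exists us : seq 'X_{1..n},
    [/\ uniq us,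
        forall u, u \in us <-> min_mon_gen L u,
        same_ideal L (monomial_span us)
      & forall i, (0 < i < size us)%N ->
          exists V : {set 'I_n},
            same_ideal (colon (monomial_span (take i us))
                              (monomial_span [:: nth 0%MM us i]))
                       (var_ideal V)].

(* A resolution
     0 -> S(-d-p)^(b p) -> ... -> S(-d-1)^(b 1) -> S(-d)^(b 0) -> L -> 0,
   acting on row vectors.  The differentials are homogeneous of degree 0, so
   their entries are linear forms; such a resolution is automatically
   minimal. *)
Definition linear_resolution_of_degree L (d : nat) : Prop :=
  exists (p : nat) (b : nat -> nat) (g : 'cV[S]_(b 0%N))
         (D : forall i, 'M[S]_(b i.+1, b i)),
    [/\ forall i, (p < i)%N -> b i = 0%N,
        (forall j, g j 0 \is d.-homog) /\
        (forall i j l, D i j l \is 1.-homog),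
        forall f, L f <-> exists c : 'rV[S]_(b 0%N), (c *m g) 0 0 = f,
        forall c : 'rV[S]_(b 0%N), c *m g = 0 <-> exists c', c = c' *m D 0%N
      & forall i (c : 'rV[S]_(b i.+1)),
          c *m D i = 0 <-> exists c', c = c' *m D i.+1].

Definition has_linear_resolution L : Prop :=
  exists d, linear_resolution_of_degree L d.

Definition degree_component_ideal L (d : nat) : S -> Prop :=
  ideal_gen (fun f => L f /\ f \is d.-homog).

Definition componentwise_linear L : Prop :=
  forall d, has_linear_resolution (degree_component_ideal L d).

(* I is the intersection of the P_i^(e i), P_i being generated by the x_j with
   j in F i. *)
Definition minimal_intersection (r : nat) (F : 'I_r -> {set 'I_n})
    (e : 'I_r -> nat) (I : S -> Prop) : Prop :=
  [/\ (0 < r)%N,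
      forall i, (0 < e i)%N /\ F i != set0,
      forall i j, i != j ->
        ~ (forall f, var_ideal (F i) f -> var_ideal (F j) f)
    & same_ideal I (fun f => forall i, ideal_pow (var_ideal (F i)) (e i) f)].

(* The monomial x^a t^k of S[t] is encoded by its exponent (a, k). *)
Definition tmon (w : 'X_{1..n} * nat) : {poly S} := ('X_[w.1])%:P * 'X^(w.2).

Definition tmon_gt (w w' : 'X_{1..n} * nat) : bool :=
  (w'.2 < w.2)%N || ((w.2 == w'.2) && lex_gt w.1 w'.1).

Definition min_monomial_generators (R : {poly S} -> Prop) (m : nat)
    (w : 'I_m -> 'X_{1..n} * nat) : Prop :=
  [/\ injective w,
      forall p, R p <-> algebra_gen (fun q => exists i, q = tmon (w i)) p
    & forall i,
        ~ algebra_gen (fun q => exists2 j, j != i & q = tmon (w j))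
                      (tmon (w i))].

(* T = S[y_1, ..., y_m] is {mpoly {mpoly K[n]}[m]}; its monomial x^u y^v is
   encoded by the pair (u, v). *)
Section Presentation.

Variable m : nat.
Local Notation T := {mpoly {mpoly K[n]}[m]}.
Local Notation mon := ('X_{1..n} * 'X_{1..m})%type.

Definition presentation_map (w : 'I_m -> 'X_{1..n} * nat) : T -> {poly S} :=
  mmap polyC (fun i => tmon (w i)).

Definition presentation_ideal (w : 'I_m -> 'X_{1..n} * nat) : T -> Prop :=
  fun p => presentation_map w p = 0.

Definition xymon (z : mon) : T := 'X_[z.1] *: 'X_[z.2].

Definition xy_coeff (p : T) (z : mon) : K := (p@_z.2)@_z.1.

Definition is_initial (gt : rel mon) (p : T) (z : mon) : Prop :=
  xy_coeff p z != 0 /\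
  forall z', xy_coeff p z' != 0 -> z' != z -> gt z z'.

Definition initial_ideal (gt : rel mon) (J : T -> Prop) : T -> Prop :=
  ideal_gen (fun q => exists p z, [/\ J p, is_initial gt p z & q = xymon z]).

Definition min_xymon_gen (L : T -> Prop) (z : mon) : Prop :=
  L (xymon z) /\
  forall z', L (xymon z') -> (z'.1 <= z.1)%MM -> (z'.2 <= z.2)%MM -> z' = z.

Definition x_condition (gt : rel mon) (J : T -> Prop) : Prop :=
  forall z, min_xymon_gen (initial_ideal gt J) z -> (mdeg z.1 <= 1)%N.

End Presentation.

End Monomial.

Definition xy_gt n m (z z' : 'X_{1..n} * 'X_{1..m}) : bool :=
  rlex_gt z.2 z'.2 || ((z.2 == z'.2) && lex_gt z.1 z'.1).

Section Covers.

Variables (n r : nat) (F : 'I_r -> {set 'I_n}) (e : 'I_r -> nat).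

Definition cover (k : nat) (a : 'X_{1..n}) : Prop :=
  forall i, (k * e i <= \sum_(j in F i) a j)%N.

Definition indecomposable_cover (k : nat) (a : 'X_{1..n}) : Prop :=
  cover k a /\
  ~ exists (a1 a2 : 'X_{1..n}) (p1 p2 : nat),
      [/\ a1 != 0%MM /\ a2 != 0%MM, cover p1 a1, cover p2 a2,
          a = (a1 + a2)%MM & k = (p1 + p2)%N].

Definition linear_cover_function : Prop :=
  exists c d : nat, forall k a, (0 < k)%N -> indecomposable_cover k a ->
    mdeg a = (c * k + d)%N.

End Covers.

(* Main.v *)
Require Import Defs.
From HB Require Import structures.
From mathcomp Require Import all_boot all_order all_algebra ring zify.
From mathcomp.multinomials Require Import mpoly.
From Stdlib Require Import Classical.

Set Implicit Arguments.
Unset Strict Implicit.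
Unset Printing Implicit Defensive.

Import GRing.Theory.
Local Open Scope ring_scope.

(** A monomial [x^a t^k] of [S[t]] lies in the symbolic Rees algebra iff [a] is a
    [k]-cover, and each such monomial is the image of a unique standard monomial
    [x^f y^b] of [T] modulo [J].  List the monomials of [I^(k)] by increasing
    standard monomial.  If [x^a'] precedes [x^a] and their [y]-parts differ, the
    least common multiple of the two has two presentations, so that the
    [x]-condition provides a variable [x_l] dividing [x^a' : x^a] and a
    rewriting [x_l y^b ~ x^h y^b''] with [b''] smaller than [b].  The linear
    cover function makes the [x]-degree an affine function of [|b|] for fixed
    [k], which forces [h] to be nonzero and the new monomial to come earlier in
    the list.  If the [y]-parts agree, the lexicographic order on the [x]-parts
    gives the same exchange.  Thus both the minimal generators of [I^(k)] and all
    its monomials of a given degree have linear quotients; in the second case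
    iterated horseshoes, whose lifts can be taken homogeneous, produce a linear
    resolution (the Koszul complex on a set of variables being itself an
    instance). *)

(** * Ideals generated by a set *)

Section IdealGen.

Variable A : comNzRingType.
Implicit Types (G L : A -> Prop).

Lemma ideal_gen_sub G L :
  is_ideal L -> (forall f, G f -> L f) -> forall f, ideal_gen G f -> L f.
Proof.
case=> L0 LD LM GL f [s sG ->] {f}.
elim: s sG => [|p s IHs] sG; first by rewrite big_nil.
rewrite big_cons; apply: LD; first by apply/LM/GL/sG; rewrite mem_head.
by apply: IHs => q qs; apply: sG; rewrite in_cons qs orbT.
Qed.

Lemma ideal_gen_mem G f : G f -> ideal_gen G f.
Proof.
move=> Gf; exists [:: (1, f)] => [p|]; last by rewrite big_seq1 mul1r.
by rewrite inE => /eqP->.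
Qed.

Lemma ideal_gen_is_ideal G : is_ideal (ideal_gen G).
Proof.
split.
- by exists [::] => //; rewrite big_nil.
- move=> _ _ [s sG ->] [t tG ->]; exists (s ++ t); last by rewrite big_cat.
  by move=> p; rewrite mem_cat => /orP[/sG|/tG].
- move=> f _ [s sG ->]; exists [seq (f * p.1, p.2) | p <- s].
    by move=> _ /mapP[p /sG ? ->].
  by rewrite big_map mulr_sumr; apply: eq_bigr => p _; rewrite mulrA.
Qed.

Lemma ideal_sum L (I : eqType) (s : seq I) (f : I -> A) :
  is_ideal L -> (forall i, i \in s -> L (f i)) -> L (\sum_(i <- s) f i).
Proof.
case=> L0 LD _; elim: s => [|i s IHs] sL; first by rewrite big_nil.
rewrite big_cons; apply: LD; first by apply/sL/mem_head.
by apply: IHs => j js; apply: sL; rewrite in_cons js orbT.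
Qed.

End IdealGen.

(** * Monomial ideals through supports *)

Section MonomialSpan.

Variables (K : fieldType) (n : nat).
Local Notation S := {mpoly K[n]}.
Implicit Types (us : seq 'X_{1..n}) (u v : 'X_{1..n}) (f g : S).

(** For [U] closed under adding exponents this is the monomial ideal with exponent set [U];
    membership becomes a condition on one exponent at a time. *)
Definition supp_ideal (U : 'X_{1..n} -> Prop) : S -> Prop :=
  fun f => forall u, u \in msupp f -> U u.

Lemma supp_idealD (U : 'X_{1..n} -> Prop) f g :
  supp_ideal U f -> supp_ideal U g -> supp_ideal U (f + g).
Proof.
by move=> Uf Ug u /msuppD_le; rewrite mem_cat => /orP[/Uf|/Ug].
Qed.

Lemma supp_ideal_is_ideal (U : 'X_{1..n} -> Prop) :
  (forall u v, U v -> U (u + v)%MM) -> is_ideal (supp_ideal U).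
Proof.
move=> Uadd; split; first by move=> u; rewrite msupp0.
- exact: supp_idealD.
- move=> f g Ug u /msuppM_le /allpairsP[[a b] /= [_ /Ug Ub ->]].
  exact: Uadd.
Qed.

Lemma supp_idealX (U : 'X_{1..n} -> Prop) u : supp_ideal U 'X_[u] <-> U u.
Proof.
split=> [|Uu v]; first by apply; rewrite msuppX mem_head.
by rewrite msuppX inE => /eqP->.
Qed.

Lemma supp_ideal_eq0 (U : 'X_{1..n} -> Prop) f :
  (forall u, ~ U u) -> supp_ideal U f -> f = 0.
Proof.
move=> U0 Uf; apply/eqP; rewrite -msupp_eq0; move: Uf; rewrite /supp_ideal.
by case: (msupp f) => // v s /(_ v); rewrite mem_head => /(_ isT)/U0.
Qed.

Lemma monomial_spanE us f :
  monomial_span us f <->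
  supp_ideal (fun u => exists2 v, v \in us & (v <= u)%MM) f.
Proof.
split.
  move: f; apply: ideal_gen_sub; last first.
    by move=> _ [u u_us ->]; apply/supp_idealX; exists u => //; apply: lepm_refl.
  apply: supp_ideal_is_ideal => u v [t t_us tv]; exists t => //.
  by apply: (lepm_trans tv); rewrite lem_addl ?lepm_refl.
move=> Uf; rewrite [f]mpolyE; apply: ideal_sum; first exact: ideal_gen_is_ideal.
move=> u /Uf[v v_us vu]; rewrite -(submK vu) mpolyXD -mul_mpolyC mulrA.
have [_ _ idM] := ideal_gen_is_ideal (fun h : S => exists2 v, v \in us & h = 'X_[v]).
by apply/idM/ideal_gen_mem; exists v.
Qed.

Lemma monomial_span_nil f : monomial_span [::] f <-> f = 0.
Proof.
rewrite monomial_spanE; split=> [|-> u]; last by rewrite msupp0.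
by apply: supp_ideal_eq0 => u [].
Qed.

Lemma monomial_spanX us u :
  monomial_span (K := K) us 'X_[u] <-> exists2 v, v \in us & (v <= u)%MM.
Proof. by rewrite monomial_spanE supp_idealX. Qed.

Lemma var_idealE (V : {set 'I_n}) f :
  var_ideal V f <-> monomial_span [seq U_(j)%MM | j <- enum V] f.
Proof.
split; move: f; apply: (ideal_gen_sub (ideal_gen_is_ideal _)) => f [].
  move=> j jV ->; apply: ideal_gen_mem; exists U_(j)%MM => //.
  by rewrite map_f ?mem_enum.
move=> _ /mapP[j jV ->] ->; apply: ideal_gen_mem; exists j => //.
by rewrite -mem_enum.
Qed.

Lemma monomial_span_rcons us u f :
  monomial_span (rcons us u) f <->
  exists h s, monomial_span us h /\ f = h + s * 'X_[u].
Proof.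
split; last first.
  case=> h [s [us_h ->]].
  have [_ idD idM] := ideal_gen_is_ideal
    (fun h : S => exists2 v, v \in rcons us u & h = 'X_[v]).
  apply: idD; last first.
    by apply/idM/ideal_gen_mem; exists u; rewrite // mem_rcons mem_head.
  apply: (ideal_gen_sub (ideal_gen_is_ideal _) _ us_h) => _ [v v_us ->]; apply: ideal_gen_mem.
  by exists v; rewrite // mem_rcons in_cons v_us orbT.
have [id0 idD idM] := ideal_gen_is_ideal (fun h : S => exists2 v, v \in us & h = 'X_[v]).
move: f; apply: ideal_gen_sub.
  split.
  - by exists 0, 0; rewrite mul0r addr0.
  - move=> _ _ [h1 [s1 [us1 ->]]] [h2 [s2 [us2 ->]]].
    by exists (h1 + h2), (s1 + s2); split; [apply: idD | rewrite mulrDl addrACA].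
  - move=> q _ [h [s [us_h ->]]]; exists (q * h), (q * s).
    by split; [apply: idM | rewrite mulrDr mulrA].
move=> f [v]; rewrite mem_rcons in_cons => /orP[/eqP-> -> | v_us ->].
  by exists 0, 1; rewrite add0r mul1r.
exists 'X_[v], 0; rewrite mul0r addr0; split=> //.
by apply: ideal_gen_mem; exists v.
Qed.

(** Multiplying by a monomial shifts supports without cancellation, so the colon ideal of [us] by
    [x^u] is again described by a support condition. *)
Lemma monomial_span_mulX us u s :
  monomial_span us (s * 'X_[u]) <->
  supp_ideal (fun t => exists2 v, v \in us & (v <= u + t)%MM) s.
Proof.
rewrite monomial_spanE; split=> H t.
  by move=> ts; apply: H; rewrite (perm_mem (msuppMX s u)) map_f.
by rewrite (perm_mem (msuppMX s u)) => /mapP[t' /H ? ->].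
Qed.

End MonomialSpan.

(** * Linear resolutions and linear quotients *)

Section LinearResolutions.

Variables (K : fieldType) (n : nat).
Local Notation S := {mpoly K[n]}.

Definition mx_homog (d p q : nat) (M : 'M[S]_(p, q)) :=
  forall i j, M i j \is d.-homog.

(** By linearity [p] may be a monomial, and then both sides vanish or both are the whole product.
    Taking graded components is thus compatible with homogeneous matrices. *)
Lemma pihomogMr (d e : nat) (p q : S) : q \is e.-homog ->
  pihomog mdeg (d + e) (p * q) = pihomog mdeg d p * q.
Proof.
move=> hq; rewrite [p]mpolyE mulr_suml !raddf_sum mulr_suml /=.
apply: eq_bigr => u _; rewrite -scalerAl !linearZ /= -scalerAl; congr (_ *: _).
rewrite pihomogX; have hX : 'X_[K, u] * q \is (mdeg u + e).-homog.
  by apply: dhomogM; rewrite ?dhomogX.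
case: eqP => [ud | /eqP ud]; first by rewrite -ud pihomog_dE.
by rewrite mul0r (pihomog_ne0 _ hX) ?eqn_add2r.
Qed.

Lemma map_pihomog_mulmx (d e p q : nat) (x : 'rV[S]_p) (M : 'M[S]_(p, q)) :
  mx_homog e M ->
  map_mx (pihomog mdeg (d + e)) (x *m M) = map_mx (pihomog mdeg d) x *m M.
Proof.
move=> hM; apply/rowP=> j; rewrite !mxE raddf_sum; apply: eq_bigr => i _.
by rewrite !mxE -(pihomogMr _ _ (hM i j)).
Qed.

(* [N] has a resolution of length at most [q] whose maps, the augmentation
   included, are given by matrices of linear forms. *)
Fixpoint linear_syzygies (q b : nat) (N : 'rV[S]_b -> Prop) : Prop :=
  if q is q'.+1 then
    exists (b' : nat) (D : 'M[S]_(b', b)),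
      [/\ mx_homog 1 D, forall x, N x <-> exists c, c *m D = x
        & @linear_syzygies q' b' (fun c => c *m D = 0)]
  else forall x, N x <-> x = 0.

Lemma linear_syzygies_ext q b (N N' : 'rV[S]_b -> Prop) :
  (forall x, N x <-> N' x) -> linear_syzygies q N -> linear_syzygies q N'.
Proof.
case: q => [|q] /= NN'; first by move=> N0 x; rewrite -NN' N0.
by case=> b' [D [hD ND kD]]; exists b', D; split=> // x; rewrite -NN' ND.
Qed.

Lemma linear_syzygiesS q b (N : 'rV[S]_b -> Prop) :
  linear_syzygies q N -> linear_syzygies q.+1 N.
Proof.
elim: q b N => [|q IHq] b N; last first.
  by case=> b' [D [hD ND kD]]; exists b', D; split=> //; apply: IHq.
move=> N0; exists 0%N, 0; split=> [i j|x|x] /=; first by rewrite mxE dhomog0.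
  by rewrite N0; split=> [->|[c <-]]; [exists 0 |]; rewrite mulmx0.
by rewrite mulmx0 thinmx0.
Qed.

(* The horseshoe lemma: an element [x] lifting a row of the presentation of [W]
   can be chosen homogeneous, which keeps the block matrix linear. *)
Lemma linear_syzygies_horseshoe q e a b c (M1 : 'M[S]_(b, a)) (M2 : 'M_(c, a))
    (W : 'rV_c -> Prop) :
  mx_homog e M1 -> mx_homog e M2 ->
  linear_syzygies q (fun x => x *m M1 = 0) -> linear_syzygies q W ->
  (forall y, W y <-> exists x, x *m M1 + y *m M2 = 0) ->
  linear_syzygies q (fun z => z *m col_mx M1 M2 = 0).
Proof.
elim: q e a b c M1 M2 W => [|q IHq] e a b c M1 M2 W hM1 hM2 /=.
  move=> k0 W0 WE z; split=> [|->]; last exact: mul0mx.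
  rewrite -[z]hsubmxK mul_row_col => z0.
  have y0 : rsubmx z = 0 by apply/W0/WE; exists (lsubmx z).
  by move: z0; rewrite y0 mul0mx addr0 => /k0 ->; rewrite row_mx0.
case=> b' [D [hD kD sD]] [c' [E [hE kE sE]]] WE.
have [L LP] : exists L : 'I_c' -> 'rV[S]_b, forall i,
    mx_homog 1 (L i) /\ L i *m M1 + row i E *m M2 = 0.
  apply: (@fin_all_exists _ (fun=> _)
            (fun i x => mx_homog 1 x /\ x *m M1 + row i E *m M2 = 0)) => i.
  have [|x xE] := (WE (row i E)).1.
    by apply/kE; exists (delta_mx 0 i); rewrite -rowE.
  (* The entries of [row i E] are linear, so the degree-1 part of [x] solves the same equation. *)
  exists (map_mx (pihomog mdeg 1) x); split.
    by move=> j l; rewrite mxE pihomogP.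
  have riE : map_mx (pihomog mdeg 1) (row i E) = row i E.
    by apply/rowP=> j; rewrite !mxE pihomog_dE.
  rewrite -(map_pihomog_mulmx 1 x hM1) -{1}riE -(map_pihomog_mulmx 1 _ hM2).
  by rewrite -map_mxD xE map_mx0.
pose L' := \matrix_i L i.
have LE : L' *m M1 + E *m M2 = 0.
  apply/row_matrixP=> i.
  by rewrite linearD /= !row_mul rowK (LP i).2 row0.
exists (b' + c')%N, (block_mx D 0 L' E); split.
- move=> i j; rewrite !mxE; case: splitP => i' _; rewrite mxE;
    case: splitP => j' _ //; rewrite ?mxE ?dhomog0 //.
  exact: (LP i').1.
- have DM1 (x : 'rV_b') : x *m D *m M1 = 0 by apply/kD; exists x.
  move=> z; split=> [|[z' <-]]; last first.
    rewrite -[z']hsubmxK mul_row_block mulmx0 add0r mul_row_col mulmxDl DM1 add0r.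
    by rewrite -!mulmxA -mulmxDr LE mulmx0.
  rewrite -[z]hsubmxK mul_row_col => z0.
  have /kE[y yE] : W (rsubmx z) by apply/WE; exists (lsubmx z).
  have /kD[x xE] : (lsubmx z - y *m L') *m M1 = 0.
    rewrite mulmxBl; move: LE => /(canRL (addrK _)); rewrite sub0r => LE.
    by rewrite -mulmxA LE mulmxN opprK mulmxA yE.
  by exists (row_mx x y); rewrite mul_row_block mulmx0 add0r yE xE subrK.
- have h0 p : mx_homog 1 (0 : 'M[S]_(b', p)) by move=> i j; rewrite mxE dhomog0.
  have hrow p p' p'' (A : 'M[S]_(p, p')) (B : 'M[S]_(p, p'')) :
      mx_homog 1 A -> mx_homog 1 B -> mx_homog 1 (row_mx A B).
    by move=> hA hB i j; rewrite mxE; case: splitP.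
  (* The syzygies of the block matrix form an extension of the same kind, of the kernel of [E] by
     that of [D]; both block rows are linear, hence degree [1] in place of [e]. *)
  apply: (IHq 1%N _ _ _ (row_mx D 0) (row_mx L' E) (fun y => y *m E = 0)) => //.
  + exact: hrow.
  + by apply: hrow => // i j; rewrite mxE; apply: (LP i).1.
  + apply: linear_syzygies_ext sD => x; rewrite mul_mx_row mulmx0.
    by split=> [->|]; [rewrite row_mx0 | rewrite -row_mx0 => /eq_row_mx[]].
  + move=> y; split=> [yE|[x]]; last first.
      rewrite !mul_mx_row mulmx0 add_row_mx add0r -row_mx0.
      by case/eq_row_mx.
    have /kD[x xE] : (y *m L') *m M1 = 0.
      move: LE => /(canRL (addrK _)); rewrite sub0r => LE.
      by rewrite -mulmxA LE mulmxN mulmxA yE mul0mx oppr0.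
    exists (- x); rewrite !mul_mx_row mulmx0 add_row_mx add0r mulNmx xE addNr.
    by rewrite yE row_mx0.
Qed.

Lemma linear_syzygies_resolution q b (N : 'rV[S]_b -> Prop) :
  linear_syzygies q N ->
  exists (bs : nat -> nat) (E : 'M[S]_(bs 0%N, b))
         (D : forall i, 'M[S]_(bs i.+1, bs i)),
  [/\ forall i, (q <= i)%N -> bs i = 0%N,
      mx_homog 1 E /\ (forall i, mx_homog 1 (D i)),
      forall x, N x <-> exists c, x = c *m E,
      forall c : 'rV_(bs 0%N), c *m E = 0 <-> exists c', c = c' *m D 0%N
    & forall i (c : 'rV_(bs i.+1)), c *m D i = 0 <-> exists c', c = c' *m D i.+1].
Proof.
elim: q b N => [|q IHq] b N /=.
  move=> N0; exists (fun=> 0%N), 0, (fun=> 0).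
  split=> //; first by split=> [i j|l i j]; rewrite mxE dhomog0.
  - by move=> x; rewrite N0; split=> [->|[c ->]]; [exists 0|]; rewrite mulmx0.
  - by move=> c; split=> _; [exists 0; rewrite !thinmx0 | rewrite mulmx0].
  - by move=> i c; split=> _; [exists 0; rewrite !thinmx0 | rewrite mulmx0].
case=> b' [D0 [hD0 ND0 /IHq[bs [E [D [bs0 [hE hD] kD0 kE kD]]]]]].
pose bs' i := if i is j.+1 then bs j else b'.
exists bs', D0.
exists (fun i => match i return 'M_(bs' i.+1, bs' i) with
                 | 0%N => E | j.+1 => D j end).
split=> //; first by case.
- by split=> // -[].
- by move=> x; rewrite ND0; split=> -[c xE]; exists c.
- by case=> [|i] c; [apply: kE | apply: kD].
Qed.

(** Induction on the list: the relations of [rcons us u] are an extension of the colon ideal of [us]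
    by [u], read off the last coordinate, by the relations of [us]. The horseshoe lemma joins the
    two resolutions without raising the length. *)
Lemma linear_syzygies_monomial_span q d (us : seq 'X_{1..n}) :
  (forall u, u \in us -> mdeg u = d) ->
  (forall i, (i < size us)%N -> @linear_syzygies q 1
     (fun c => monomial_span (take i us) (c 0 0 * 'X_[nth 0%MM us i]))) ->
  exists b (g : 'cV[S]_b),
    [/\ mx_homog d g, forall f, monomial_span us f <-> exists c : 'rV_b, (c *m g) 0 0 = f
      & linear_syzygies q (fun c => c *m g = 0)].
Proof.
elim/last_ind: us => [|us u IHus] degs sus.
  exists 0%N, 0; split.
  - by move=> i; case: i.
  - move=> f; rewrite monomial_span_nil; split=> [->|[c <-]].
      by exists 0; rewrite mulmx0 mxE.
    by rewrite mulmx0 mxE.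
  - have: @linear_syzygies 0 0 (fun c => c *m (0 : 'cV[S]_0) = 0).
      by move=> c; rewrite mulmx0; split=> // _; rewrite thinmx0.
    by elim: {sus} q => // q IHq /IHq; apply: linear_syzygiesS.
have [|i i_us|b [g [hg gE sg]]] := IHus.
- by move=> v v_us; apply: degs; rewrite mem_rcons in_cons v_us orbT.
- have := sus i; rewrite size_rcons ltnS (ltnW i_us) nth_rcons i_us => /(_ isT).
  by rewrite -cats1 takel_cat // ltnW.
have hu : mx_homog d ('X_[u]%:M : 'M[S]_1).
  move=> i j; rewrite !ord1 mxE eqxx mulr1n dhomogX.
  by apply/eqP/degs; rewrite mem_rcons mem_head.
exists (b + 1)%N, (col_mx g 'X_[u]%:M); split.
- by move=> i j; rewrite mxE; case: splitP.
- move=> f; rewrite monomial_span_rcons; split.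
    case=> h [s [/gE[c <-] ->]]; exists (row_mx c s%:M).
    by rewrite mul_row_col -scalar_mxM !mxE eqxx mulr1n.
  case=> c <-; exists ((lsubmx c *m g) 0 0), (rsubmx c 0 0); split.
    by apply/gE; exists (lsubmx c).
  by rewrite -{1}[c]hsubmxK mul_row_col mul_mx_scalar !mxE mulrC.
- have := sus (size us); rewrite size_rcons ltnSn => /(_ isT).
  rewrite nth_rcons ltnn eqxx -cats1 take_size_cat // => su.
  apply: linear_syzygies_horseshoe hg hu sg su _ => y; rewrite gE.
  have yE (c : 'rV_b) : c *m g + y *m 'X_[u]%:M = 0 <->
      (- c *m g) 0 0 = y 0 0 * 'X_[u].
    rewrite mulNmx mxE [c *m g]mx11_scalar {1}[y]mx11_scalar -scalar_mxM -raddfD.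
    set cg := (c *m g) 0 0; rewrite mxE eqxx mulr1n; split=> [|<-].
      move/matrixP/(_ 0 0); rewrite !mxE eqxx mulr1n => /eqP.
      by rewrite addrC addr_eq0 => /eqP->.
    by rewrite subrr raddf0.
  split=> [[c cE] | [c /yE cE]]; last by exists (- c).
  by exists (- c); apply/yE; rewrite opprK.
Qed.

(** The colon ideal of the earlier variables by the next one is generated by these earlier ones, so
    induction on [q] supplies the resolutions that [linear_syzygies_monomial_span] asks for. *)
Lemma linear_syzygies_vars q (vs : seq 'I_n) : uniq vs -> (size vs <= q)%N ->
  @linear_syzygies q 1 (fun c => monomial_span [seq U_(j)%MM | j <- vs] (c 0 0)).
Proof.
elim: q vs => [|q IHq] vs uvs.
  rewrite leqn0 size_eq0 => /eqP-> /= x; rewrite monomial_span_nil.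
  by split=> [x0|->]; [apply/rowP=> i; rewrite ord1 x0|]; rewrite mxE.
move=> vs_q; pose us := [seq U_(j)%MM | j <- vs].
have [u|i|b [g [hg gE sg]]] := @linear_syzygies_monomial_span q 1 us.
- by case/mapP=> j _ ->; rewrite mdeg1.
- rewrite size_map => i_vs; have [j jE] : exists j, forall j0, nth j0 vs i = j.
    by exists (tnth (in_tuple vs) (Ordinal i_vs)) => j0; rewrite (tnth_nth j0).
  rewrite (nth_map j) // jE -map_take.
  have j_take : j \notin take i vs.
    have := uvs; rewrite -{1}(cat_take_drop i vs) (drop_nth j) // jE cat_uniq.
    by case/and3P=> _ /norP[].
  have svs : (size (take i vs) <= q)%N.
    by rewrite size_takel ?(ltnW i_vs) // -ltnS (leq_trans i_vs).
  apply: linear_syzygies_ext (IHq _ (take_uniq i uvs) svs) => c.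
  rewrite monomial_spanE monomial_span_mulX.
  split=> H t /H[_ /mapP[l l_vs ->] lt]; exists U_(l)%MM; rewrite ?map_f //.
    by rewrite (lepm_trans lt) // lem_addl.
  move: lt; rewrite !lep1mP mnmDE mnm1E; have [jl|_] := eqVneq j l; last by rewrite add0n.
  by move: j_take; rewrite jl l_vs.
exists b, g; split=> // x; rewrite gE.
split=> -[c cE]; exists c; last by rewrite cE.
by apply/rowP=> i; rewrite !ord1 cE.
Qed.

(** Combinatorial form of linear quotients: for [j < i] some variable [x_l] divides [u_j : u_i], and
    an earlier [u_j'] divides [x_l u_i], so that [x_l] lies in the colon ideal. *)
Definition linear_exchange (us : seq 'X_{1..n}) : Prop :=
  forall i j, (j < i < size us)%N -> exists (l : 'I_n) (j' : nat),
    [/\ (j' < i)%N, (nth 0%MM us i l < nth 0%MM us j l)%N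
      & (nth 0%MM us j' <= nth 0%MM us i + U_(l))%MM].

(** [V] collects the [l] for which an earlier generator divides [x_l u_i]; the exchange finds such
    an [x_l] dividing any given monomial of the colon ideal. *)
Lemma linear_exchange_colon us i : linear_exchange us -> (i < size us)%N ->
  exists V : {set 'I_n}, forall f : S,
    monomial_span (take i us) (f * 'X_[nth 0%MM us i]) <-> var_ideal V f.
Proof.
move=> lus i_us; set u := nth _ us i.
exists [set l | has (fun v => (v <= u + U_(l))%MM) (take i us)] => f.
rewrite var_idealE monomial_span_mulX monomial_spanE.
split=> H t /H[v].
  move=> /(nthP 0%MM)[j]; rewrite size_takel ?(ltnW i_us) // => ji.
  rewrite nth_take // => <- /mnm_lepP vt.
  have [|l [j' [j'i ul j'_le]]] := lus i j; first by rewrite ji.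
  exists U_(l)%MM.
    rewrite map_f // mem_enum inE; apply/hasP; exists (nth 0%MM us j') => //.
    by rewrite -(nth_take _ j'i) mem_nth // size_takel ?(ltnW i_us).
  rewrite lep1mP -lt0n; have := leq_trans ul (vt l).
  by rewrite mnmDE -[X in (X < _)%N]addn0 ltn_add2l.
case/mapP=> l; rewrite mem_enum inE => /hasP[w w_us wu] -> lt.
exists w => //; apply: (lepm_trans wu); apply/mnm_lepP=> x.
by rewrite !mnmDE leq_add2l; apply: (mnm_lepP lt).
Qed.

Lemma colon_monomial (us : seq 'X_{1..n}) u f :
  colon (monomial_span (K := K) us) (monomial_span [:: u]) f <->
  monomial_span us (f * 'X_[u]).
Proof.
split=> [|fu g]; first by apply; apply/monomial_spanX; exists u; rewrite ?mem_head ?lepm_refl.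
have [id0 idD idM] := ideal_gen_is_ideal (fun h : S => exists2 v, v \in us & h = 'X_[v]).
move: g; apply: ideal_gen_sub.
  split=> [|g h fg fh|g h fh]; first by rewrite mulr0.
  - by rewrite mulrDr; apply: idD.
  - by rewrite mulrCA; apply: idM.
by move=> g [v]; rewrite inE => /eqP-> ->.
Qed.

(** Each colon ideal is generated by at most [n] variables, so [n] bounds the length of its
    resolution and hence that of the whole one. *)
Lemma linear_exchange_resolution us d :
  linear_exchange us -> (forall u : 'X_{1..n}, u \in us -> mdeg u = d) ->
  linear_resolution_of_degree (monomial_span (K := K) us) d.
Proof.
move=> lus degs.
have [//|i i_us|b [g [hg gE sg]]] := @linear_syzygies_monomial_span n d us.
  have [V VE] := linear_exchange_colon lus i_us.
  have sV : (size (enum V) <= n)%N by rewrite -cardE (leq_trans (max_card _)) ?card_ord.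
  apply: linear_syzygies_ext (linear_syzygies_vars (enum_uniq V) sV) => c.
  by rewrite VE var_idealE.
have [bs [E [D [bs0 [hE hD] NE kE kD]]]] := linear_syzygies_resolution sg.
pose bs' i := if i is j.+1 then bs j else b.
exists n, bs', g.
exists (fun i => match i return 'M_(bs' i.+1, bs' i) with
                 | 0%N => E | j.+1 => D j end).
split.
- by case=> // i; apply: bs0.
- by split=> [j|]; [apply: hg | case].
- exact: gE.
- exact: NE.
- by case=> [|i] c; [apply: kE | apply: kD].
Qed.

End LinearResolutions.

(** * Powers of ideals *)

Section IdealPow.

Variable A : comNzRingType.
Implicit Types (L : A -> Prop).

Lemma ideal_pow0 L f : ideal_pow L 0 f.
Proof.
rewrite -[f]mulr1; have [_ _ idM] := ideal_gen_is_ideal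
  (fun f => exists2 g : 'I_0 -> A, forall i, L (g i) & f = \prod_(i < 0) g i).
by apply/idM/ideal_gen_mem; exists (fun=> 0); [case | rewrite big_ord0].
Qed.

Lemma ideal_powS L k f g : L f -> ideal_pow L k g -> ideal_pow L k.+1 (f * g).
Proof.
move=> Lf; rewrite /ideal_pow; set G := fun h : A => exists2 g : 'I_k.+1 -> A, _ & _.
have [id0 idD idM] := ideal_gen_is_ideal G.
move: g; apply: ideal_gen_sub.
  split=> [|g h fg fh|g h fh]; first by rewrite mulr0.
  - by rewrite mulrDr; apply: idD.
  - by rewrite mulrCA; apply: idM.
move=> h [g Lg ->]; apply: ideal_gen_mem.
exists (fun i => oapp g f (unlift ord0 i)) => [i|].
  by case: (unlift ord0 i) => [j|] //=.
rewrite big_ord_recl unlift_none; congr (_ * _).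
by apply: eq_bigr => i _; rewrite liftK.
Qed.

End IdealPow.

(** * Symbolic powers as ideals of covers *)

Section SymbolicPowers.

Variables (K : fieldType) (n : nat).
Local Notation S := {mpoly K[n]}.
Implicit Types (V : {set 'I_n}) (u v : 'X_{1..n}) (f g s : S).

(** The order of [x^u] along the prime [var_ideal V]; the cover conditions bound it from below at
    [V = F i]. *)
Definition wt V u := (\sum_(j in V) u j)%N.

Lemma wt0 V : wt V 0%MM = 0%N.
Proof. by apply: big1 => j _; rewrite mnm0E. Qed.

Lemma wtD V : {morph wt V : u v / (u + v)%MM >-> (u + v)%N}.
Proof. by move=> u v; rewrite -big_split; apply: eq_bigr => j _; rewrite mnmDE. Qed.

HB.instance Definition _ V := isMeasure.Build n (wt V) (wt0 V) (wtD V).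

Lemma wt1 V j : wt V U_(j)%MM = (j \in V).
Proof.
rewrite /wt big_mkcond (bigD1 j) //= mnm1E eqxx big1 ?addn0; last first.
  by move=> i ij; rewrite mnm1E eq_sym (negbTE ij) if_same.
by case: (j \in V).
Qed.

Lemma wt_ge V u j : j \in V -> (u j <= wt V u)%N.
Proof. by move=> jV; rewrite /wt (bigD1 j) //= leq_addr. Qed.

Lemma wt_le V u v : (u <= v)%MM -> (wt V u <= wt V v)%N.
Proof. by move=> /mnm_lepP uv; apply: leq_sum => j _. Qed.

Lemma wt_split V u c : (c <= wt V u)%N ->
  exists v, [/\ (v <= u)%MM, wt V v = c & forall j, j \notin V -> v j = 0%N].
Proof.
elim: c => [_|c IHc lt_cu].
  by exists 0%MM; split=> [||j _]; rewrite ?wt0 ?mnm0E //; apply/mnm_lepP=> j; rewrite mnm0E.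
have [v [vu vc v0]] := IHc (ltnW lt_cu).
have [/existsP[j /andP[jV lt_vu]] | ] :=
    boolP [exists j, (j \in V) && (v j < u j)%N].
  exists (v + U_(j))%MM; split=> [||i iV].
  - apply/mnm_lepP=> i; rewrite mnmDE mnm1E.
    by case: eqP => [<-|_]; rewrite ?addn1 // addn0 (mnm_lepP vu).
  - by rewrite wtD wt1 jV vc addn1.
  - rewrite mnmDE mnm1E v0 // add0n; case: eqP => // ji.
    by rewrite -ji jV in iV.
rewrite negb_exists => /forallP nlt; move: lt_cu; rewrite -vc ltnNge => /negP[].
by apply: leq_sum => j jV; have:= nlt j; rewrite jV -leqNgt.
Qed.

Definition weight_ideal V k : S -> Prop := supp_ideal (fun u => (k <= wt V u)%N).

Lemma weight_ideal_is_ideal V k : is_ideal (weight_ideal V k).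
Proof.
apply: supp_ideal_is_ideal => u v kv; rewrite wtD.
exact: leq_trans kv (leq_addl _ _).
Qed.

Lemma weight_idealM V a b f g :
  weight_ideal V a f -> weight_ideal V b g -> weight_ideal V (a + b) (f * g).
Proof.
move=> fa gb u /msuppM_le /allpairsP[[x y] /= [/fa xa /gb yb ->]].
by rewrite wtD leq_add.
Qed.

Lemma weight_ideal_pow V c k (L : S -> Prop) f :
  (forall g, L g -> weight_ideal V c g) -> ideal_pow L k f ->
  weight_ideal V (k * c) f.
Proof.
move=> Lc; move: f; apply: ideal_gen_sub; first exact: weight_ideal_is_ideal.
move=> f [g Lg ->]; elim: k g Lg => [|k IHk] g Lg; first by move=> u.
rewrite big_ord_recl mulSn; apply: weight_idealM; first exact: Lc.
exact: (IHk (fun i => g (lift ord0 i))).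
Qed.

Lemma weight_ideal_var V f : var_ideal V f <-> weight_ideal V 1 f.
Proof.
rewrite var_idealE monomial_spanE; split=> fV u /fV.
  case=> _ /mapP[j jV ->]; rewrite lep1mP -lt0n => uj.
  by apply: (leq_trans uj); apply: wt_ge; rewrite -mem_enum.
case/wt_split=> v [vu v1 v0].
have [/existsP[j /andP[jV vj]] | nv] := boolP [exists j, (j \in V) && (v j != 0%N)].
  exists U_(j)%MM; first by rewrite map_f // mem_enum.
  by apply: lepm_trans vu; rewrite lep1mP.
suff: wt V v = 0%N by rewrite v1.
by apply: big1 => j jV; move: nv; rewrite negb_exists => /forallP/(_ j);
  rewrite jV negbK => /eqP.
Qed.

(** A monomial of weight at least [k] sheds one variable of [V] at a time, which writes it as a
    multiple of a product of [k] elements of the prime. *)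
Lemma ideal_pow_var V k f : ideal_pow (var_ideal V) k f <-> weight_ideal V k f.
Proof.
split=> [|fk].
  move=> fk; rewrite -[k]muln1; apply: weight_ideal_pow fk => g.
  by rewrite weight_ideal_var.
have id_pow : is_ideal (ideal_pow (var_ideal (K := K) V) k).
  exact: ideal_gen_is_ideal.
rewrite [f]mpolyE; apply: ideal_sum => // u /fk ku; rewrite -mul_mpolyC.
have [_ _] := id_pow; apply; move: {fk id_pow} ku.
elim: k u => [|k IHk] u ku; first exact: ideal_pow0.
have [v [vu v1 _]] := wt_split (leq_ltn_trans (leq0n k) ku).
rewrite -(submK vu) addmC mpolyXD; apply: ideal_powS.
  by apply/weight_ideal_var/supp_idealX; rewrite v1.
by apply: IHk; rewrite -ltnS -[(wt V _).+1]addn1 -v1 -wtD submK.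
Qed.

Lemma mcoeff_pihomog (mf : measure n) d f u :
  (pihomog mf d f)@_u = if mf u == d then f@_u else 0.
Proof.
have piE v : (pihomog mf d (f@_v *: 'X_[v]))@_u =
    if mf u == d then (f@_v *: 'X_[v])@_u else 0.
  rewrite linearZ /= pihomogX !mcoeffZ mcoeffX; have [vu | vu] := eqVneq v u.
    by rewrite -vu; case: ifP; rewrite ?mcoeff0 ?mulr0 // mcoeffX eqxx.
  rewrite (fun_if (mcoeff u)) mcoeffX (negbTE vu) mcoeff0 mulr0.
  by rewrite !if_same mulr0.
have -> : (pihomog mf d f)@_u =
    \sum_(v <- msupp f) (pihomog mf d (f@_v *: 'X_[v]))@_u.
  by rewrite {1}[f]mpolyE (raddf_sum (pihomog mf d)) raddf_sum.
under eq_bigr => v _ do rewrite piE.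
by case: ifP => _; [rewrite -raddf_sum -mpolyE | apply: big1].
Qed.

Lemma weight_ideal_lowest V k f :
  weight_ideal V k f -> weight_ideal V k.+1 (f - pihomog (wt V) k f).
Proof.
move=> fk u; rewrite mcoeff_msupp mcoeffB mcoeff_pihomog.
have [_ | uk] := eqVneq (wt V u) k; first by rewrite subrr eqxx.
rewrite subr0 -mcoeff_msupp => /fk.
by rewrite leq_eqVlt eq_sym (negbTE uk).
Qed.

(* The weight-lowest parts of [s] and [f] multiply to a nonzero polynomial. *)
Lemma weight_ideal_prime V k s f :
  ~ weight_ideal V 1 s -> weight_ideal V k (s * f) -> weight_ideal V k f.
Proof.
move=> s0; elim: k => [|k IHk] sf; first by move=> u.
have fk : weight_ideal V k f by apply: IHk => u /sf; apply: ltnW.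
pose f0 := pihomog (wt V) k f; pose t := pihomog (wt V) 0 s.
have s1 : weight_ideal V 1 (s - t) by apply: weight_ideal_lowest => u.
have f1 : weight_ideal V k.+1 (f - f0) by apply: weight_ideal_lowest.
have [id0 idD idM] := weight_ideal_is_ideal V k.+1.
(* Modulo weight [k + 1] the factors may be replaced by their lowest parts [t] and [f0]; the product
   of these is homogeneous of weight [k], so it must vanish. *)
have tf : weight_ideal V k.+1 (t * f0).
  have -> : t * f0 = s * f + ((s - t) * - f + (- t) * (f - f0)) by ring.
  apply: (idD) => //; apply: idD; last exact: idM.
  by rewrite -[k.+1]add1n; apply: weight_idealM => // u; rewrite (perm_mem (msuppN f)) => /fk.
have tf0 : t * f0 = 0.
  have: t * f0 \is k.-homog for (wt V) by apply: (@dhomogM _ _ _ 0); apply: pihomogP.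
  move/dhomogP=> hom; apply: (@supp_ideal_eq0 _ _ (fun=> False)) => [u []|u utf].
  by have:= tf u utf; rewrite (hom u utf) ltnn.
move/eqP: tf0; rewrite mulf_eq0 => /orP[/eqP t0|/eqP f00].
  by case: s0; rewrite -[s]subr0 -t0.
by rewrite -[f]subr0 -f00.
Qed.

Section MinimalIntersection.

Variables (r : nat) (F : 'I_r -> {set 'I_n}) (e : 'I_r -> nat) (I : S -> Prop).
Hypothesis hI : minimal_intersection F e I.

Lemma minimal_intersectionE f : I f <-> supp_ideal (Defs.cover F e 1) f.
Proof.
case: hI => _ _ _ IE; rewrite IE; split=> [fF u uf i | fF i].
  by rewrite mul1n; have/ideal_pow_var/(_ u uf) := fF i.
by apply/ideal_pow_var => u /fF/(_ i); rewrite mul1n.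
Qed.

Lemma minimal_intersection_inj i j : F i \subset F j -> i = j.
Proof.
case: hI => _ _ incomp _ Fij; apply/eqP/negP=> /negP/incomp; apply=> f.
rewrite !weight_ideal_var => fF u /fF; move/leq_trans; apply.
rewrite /wt [X in (_ <= X)%N](bigID (mem (F i))) /= -[leqLHS]addn0 leq_add //.
rewrite leq_eqVlt; apply/orP/or_introl/eqP/eq_bigl => l.
by rewrite andbC; case: (boolP (l \in F i)) => // /(subsetP Fij) ->.
Qed.

Lemma assoc_prime_minimal_prime i : assoc_prime I (var_ideal (F i)).
Proof.
case: (hI) => _ /(_ i)[ei Fi0] _ _; split.
  split; first exact: ideal_gen_is_ideal.
    move/weight_ideal_var/(_ 0%MM); rewrite wt0 msupp1 mem_head.
    by move/(_ isT).
  move=> f g; rewrite !weight_ideal_var => fg.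
  have [f1|nf1] := classic (weight_ideal (F i) 1 f); [by left|right].
  exact: weight_ideal_prime fg.
have /set0Pn[l lF] := Fi0.
pose N := (\sum_j e j)%N.
(* [x^u] misses the condition at [F i] by exactly 1 and meets every other one, since each other
   [F j] has a variable outside [F i], with exponent [N >= e j]. Hence the annihilator of [x^u]
   modulo [I] is [var_ideal (F i)]. *)
pose u := (U_(l) *+ (e i).-1 + [multinom if j \in F i then 0 else N | j < n])%MM.
have wtu : wt (F i) u = (e i).-1.
  rewrite wtD -[RHS]addn0; congr (_ + _)%N; last first.
    by apply: big1 => j jF; rewrite mnmE jF.
  rewrite /wt (bigD1 l) //= mulmnE mnm1E eqxx mul1n big1 ?addn0 // => j.
  by rewrite mulmnE mnm1E eq_sym => /andP[_ /negbTE->].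
exists 'X_[u] => g; rewrite weight_ideal_var minimal_intersectionE; split=> gF v.
  rewrite (perm_mem (msuppMX g u)) => /mapP[w /gF wg ->] j; rewrite mul1n.
  have [-> | ji] := eqVneq j i.
    rewrite -/(wt _ _) wtD wtu; apply: (@leq_trans ((e i).-1 + 1)).
      by rewrite addn1 leqSpred.
    by rewrite leq_add2l.
  have /subsetPn[x xj xi] : ~~ (F j \subset F i).
    by apply: contraNN ji => /minimal_intersection_inj ->.
  apply: leq_trans (wt_ge _ xj); rewrite !mnmDE mulmnE mnmE (negbTE xi) addnAC.
  by apply: leq_trans (leq_addl _ _); rewrite /N (bigD1 j) //= leq_addr.
move=> vg; have := gF (u + v)%MM; rewrite (perm_mem (msuppMX g u)) map_f // => /(_ isT i).
by rewrite mul1n -/(wt _ _) wtD wtu; case: (e i) ei => // a _; rewrite /= -[a.+1]addn1 leq_add2l.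
Qed.

(* If [P = Ann (g + I)] and a monomial of [g] violates the [i]-th inequality,
   then a variable can lie in [P] only if it lies in [F i]. *)
Lemma assoc_prime_vars P : assoc_prime I P ->
  exists i, forall l, P 'X_l -> l \in F i.
Proof.
case=> -[_ P1 _] [g PE].
have nIg : ~ I g by rewrite -[g]mul1r => /PE.
have [u [ug [i ui]]] : exists u, u \in msupp g /\ exists i, (wt (F i) u < e i)%N.
  apply: NNPP => H; apply/nIg/minimal_intersectionE=> u ug i.
  by rewrite mul1n leqNgt; apply/negP=> ui; apply: H; exists u; split=> //; exists i.
exists i => l /PE; rewrite mulrC minimal_intersectionE => /(_ (U_(l) + u)%MM).
rewrite (perm_mem (msuppMX g _)) map_f // => /(_ isT i); rewrite mul1n.
rewrite -/(wt _ _) wtD wt1; case: (l \in F i) => //.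
by rewrite add0n leqNgt ui.
Qed.

(* Away from [V], a large power of every variable is available; inside [V] there
   is at most one [F i] whose inequality has to be split. *)
Lemma ideal_pow_monomial (V : {set 'I_n}) k u :
  (forall i j, F i \subset V -> F j \subset V -> i = j) ->
  (forall i, F i \subset V -> (k * e i <= wt (F i) u)%N) ->
  (forall l, l \notin V -> (k * (\sum_j e j) <= u l)%N) ->
  ideal_pow I k 'X_[u].
Proof.
move=> V1; elim: k u => [|k IHk] u uF uV; first exact: ideal_pow0.
have [v [vu vF v0]] : exists v, [/\ (v <= u)%MM,
    forall i, F i \subset V -> wt (F i) v = e i & forall l, l \notin V -> v l = 0%N].
  have [[i iV] | nV] := classic (exists i, F i \subset V).
    have [|v [vu vi v0]] := @wt_split (F i) u (e i).
      by apply: leq_trans (uF i iV); rewrite mulSn leq_addr.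
    exists v; split=> // [j jV|l lV]; first by rewrite (V1 j i).
    by apply: v0; apply: contraNN lV; apply: (subsetP iV).
  exists 0%MM; split=> [|i iV|l _]; rewrite ?mnm0E //; last by case: nV; exists i.
  by apply/mnm_lepP=> l; rewrite mnm0E.
pose N := (\sum_j e j)%N.
(* The factor to split off: [x^w] lies in [I], and its weight on each [F i] inside [V] is exactly
   [e i], so [u - w] still meets the bounds for one power less. *)
pose w := (v + [multinom if l \in V then 0 else N | l < n])%MM.
have wu : (w <= u)%MM.
  apply/mnm_lepP=> l; rewrite mnmDE mnmE; case: ifP => [_|/negbT lV].
    by rewrite addn0 (mnm_lepP vu).
  by rewrite v0 //; apply: leq_trans (uV l lV); rewrite mulSn leq_addr.
have wF i : F i \subset V -> wt (F i) w = e i.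
  move=> iV; rewrite wtD vF // [X in (_ + X)%N]big1 ?addn0 // => l lF.
  by rewrite mnmE (subsetP iV).
rewrite -(submK wu) addmC mpolyXD; apply: ideal_powS.
  apply/minimal_intersectionE/supp_idealX => i; rewrite mul1n.
  have [iV | /subsetPn[l li lV]] := boolP (F i \subset V).
    by rewrite -/(wt _ _) wF.
  apply: leq_trans (wt_ge _ li); rewrite mnmDE mnmE (negbTE lV).
  by apply: leq_trans (leq_addl _ _); rewrite /N (bigD1 i) //= leq_addr.
apply: IHk => [i iV|l lV].
  by rewrite -(leq_add2r (wt (F i) w)) -wtD submK // wF // -mulSnr uF.
rewrite mnmBE mnmDE mnmE (negbTE lV) v0 // add0n leq_subRL -?mulSn ?uV //.
by apply: leq_trans (uV l lV); rewrite mulSn leq_addr.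
Qed.

(** The prime of [F i] is associated, and denominators outside it do not affect its weight, which
    gives the [i]-th inequality. Conversely, at any associated prime a monomial in the variables
    outside it serves as denominator, and at most one [F i] lies inside it. *)
Lemma symbolic_powerE k f :
  symbolic_power I k f <-> supp_ideal (Defs.cover F e k) f.
Proof.
split=> [fk u uf i | fk P Pass].
  have [s sF sf] := fk _ (assoc_prime_minimal_prime i).
  have /(_ u uf) // : weight_ideal (F i) (k * e i) f.
  apply: (@weight_ideal_prime _ _ s); first by rewrite -weight_ideal_var.
  apply: weight_ideal_pow sf => g /minimal_intersectionE gI v /gI/(_ i).
  by rewrite mul1n.
have [i0 Pi0] := assoc_prime_vars Pass.
have [[_ P1 Pprime] _] := Pass.
have [V VP] : exists V : {set 'I_n}, forall l, l \in V <-> P 'X_l.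
  have [b bP] : exists b : 'I_n -> bool, forall l, b l <-> P 'X_l.
    apply: (@fin_all_exists _ (fun=> bool) (fun l b => b <-> P 'X_l)) => l.
    by have [Pl|nPl] := classic (P 'X_l); [exists true | exists false].
  by exists [set l | b l] => l; rewrite inE.
have V1 i : F i \subset V -> i = i0.
  move=> iV; apply: minimal_intersection_inj; apply/subsetP => l /(subsetP iV).
  by move/VP; apply: Pi0.
pose N := (k * \sum_j e j)%N.
pose s := [multinom if l \in V then 0 else N | l < n]%MM.
exists 'X_[s].
  rewrite mpolyXE_id => Ps.
  have PXn l a : P ('X_l ^+ a) -> P 'X_l.
    elim: a => [|a IHa]; first by rewrite expr0 => P1'; case: (P1 P1').
    by rewrite exprS => /Pprime[].
  have [l Pl] : exists l : 'I_n, P ('X_l ^+ s l).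
    apply: NNPP => nP; move: Ps; apply: (big_ind (fun f => ~ P f)) => //.
      by move=> p q np nq /Pprime[].
    by move=> l _ Pl; apply: nP; exists l.
  move: (Pl); have -> : s l = 0%N by rewrite mnmE (introT idP ((VP l).2 (PXn _ _ Pl))).
  by rewrite expr0.
rewrite [f]mpolyE mulr_sumr; apply: ideal_sum; first exact: ideal_gen_is_ideal.
move=> u /fk uk; rewrite -mul_mpolyC mulrCA -mpolyXD.
have [_ _ idM] : is_ideal (ideal_pow I k) by exact: ideal_gen_is_ideal.
apply/idM/(ideal_pow_monomial (V := V)) => [i j iV jV|i iV|l lV].
- exact: etrans (V1 _ iV) (esym (V1 _ jV)).
- by apply: leq_trans (uk i) _; apply: wt_le; rewrite lem_addl.
- by rewrite mnmDE mnmE (negbTE lV) leq_addr.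
Qed.

End MinimalIntersection.

End SymbolicPowers.

(** * The lexicographic and reverse lexicographic orders *)

Section MonomialOrders.

Variable n : nat.
Implicit Types u v t : 'X_{1..n}.

Lemma first_difference (P : pred 'I_n) : (exists i, P i) ->
  exists2 i, P i & forall j : 'I_n, (j < i)%N -> ~~ P j.
Proof.
case=> i0 Pi0; case: (arg_minnP (fun i : 'I_n => i : nat) Pi0) => i Pi min_i.
by exists i => // j ji; apply/negP=> /min_i; rewrite leqNgt ji.
Qed.

Lemma last_difference (P : pred 'I_n) : (exists i, P i) ->
  exists2 i, P i & forall j : 'I_n, (i < j)%N -> ~~ P j.
Proof.
case=> i0 Pi0; case: (arg_maxnP (fun i : 'I_n => i : nat) Pi0) => i Pi max_i.
by exists i => // j ji; apply/negP=> /max_i /=; rewrite leqNgt ji.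
Qed.

Lemma mnm_neqP u v : u != v -> exists i, u i != v i.
Proof.
move=> uv; apply/existsP; apply: contraNT uv; rewrite negb_exists => /forallP uv.
by apply/eqP/mnmP=> i; apply/eqP; rewrite -[_ == _]negbK.
Qed.

Lemma lex_gtP u v : reflect
  (exists i : 'I_n, (v i < u i)%N /\ forall j : 'I_n, (j < i)%N -> u j = v j)
  (lex_gt u v).
Proof.
apply: (iffP existsP) => -[i]; first case/andP=> lti /forallP eqj; last case=> lti eqj.
  by exists i; split=> // j ji; have:= eqj j; rewrite ji => /eqP.
by exists i; rewrite lti; apply/forallP=> j; apply/implyP=> /eqj->.
Qed.

Lemma lex_gt_irr u : lex_gt u u = false.
Proof. by apply/lex_gtP => -[i []]; rewrite ltnn. Qed.

Lemma lex_gt_trans : transitive (@lex_gt n).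
Proof.
move=> v u t /lex_gtP[i [ui ueq]] /lex_gtP[j [vj veq]]; apply/lex_gtP.
have [ij|ji|/val_inj ij] := ltngtP i j.
- by exists i; split=> [|l li]; rewrite -?veq // ?ueq // (ltn_trans li).
- by exists j; split=> [|l lj]; rewrite ?ueq // ?veq // (ltn_trans lj).
- by subst j; exists i; split=> [|l li]; [apply: ltn_trans ui | rewrite ueq ?veq].
Qed.

Lemma lex_gt_total u v : u != v -> lex_gt u v || lex_gt v u.
Proof.
move=> /mnm_neqP/first_difference[i ui eqj].
have eqj' (j : 'I_n) : (j < i)%N -> u j = v j by move/eqj; rewrite negbK => /eqP.
case: ltngtP ui => // ui _; apply/orP; [right|left]; apply/lex_gtP; exists i;
  by split=> // j /eqj'.
Qed.

Lemma lex_gtD2r t u v : lex_gt (u + t)%MM (v + t)%MM = lex_gt u v.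
Proof.
apply/lex_gtP/lex_gtP => -[i [ui eqj]]; exists i; move: ui;
  rewrite !mnmDE ltn_add2r => ui; split=> // j /eqj; rewrite !mnmDE //.
  exact: addIn.
by move=> ->.
Qed.

Lemma rlex_gtP u v : reflect
  ((mdeg v < mdeg u)%N \/ mdeg u = mdeg v /\
   exists i : 'I_n, (u i < v i)%N /\ forall j : 'I_n, (i < j)%N -> u j = v j)
  (rlex_gt u v).
Proof.
apply: (iffP orP) => -[|]; try by left.
  case/andP=> /eqP uv /existsP[i /andP[lti /forallP eqj]]; right; split=> //.
  by exists i; split=> // j ji; have:= eqj j; rewrite ji => /eqP.
case=> uv [i [lti eqj]]; right; rewrite uv eqxx; apply/existsP; exists i.
by rewrite lti; apply/forallP=> j; apply/implyP=> /eqj->.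
Qed.

Lemma rlex_gt_mdeg u v : rlex_gt u v -> (mdeg v <= mdeg u)%N.
Proof. by case/rlex_gtP => [/ltnW//|[->]]. Qed.

Lemma rlex_gt_irr u : rlex_gt u u = false.
Proof. by apply/rlex_gtP => -[|[_ [i []]]]; rewrite ltnn. Qed.

Lemma rlex_gt_trans : transitive (@rlex_gt n).
Proof.
move=> v u t uv vt; apply/rlex_gtP.
case/rlex_gtP: vt uv => [vt /rlex_gt_mdeg uv | [vtd [j [vj veq]]]].
  by left; apply: leq_trans vt uv.
case/rlex_gtP => [uv | [uvd [i [ui ueq]]]]; first by left; rewrite -vtd.
right; split; first by rewrite uvd.
have [ij|ji|/val_inj ij] := ltngtP i j.
- by exists j; split=> [|l lj]; rewrite ?ueq // ?veq // (ltn_trans ij).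
- by exists i; split=> [|l li]; rewrite -?veq // ?ueq // (ltn_trans ji).
- by subst j; exists i; split=> [|l li]; [apply: ltn_trans vj | rewrite ueq ?veq].
Qed.

Lemma rlex_gt_total u v : u != v -> rlex_gt u v || rlex_gt v u.
Proof.
rewrite /rlex_gt; case: (ltngtP (mdeg u) (mdeg v)) => //= _.
move=> /mnm_neqP/last_difference[i ui eqj].
have eqj' (j : 'I_n) : (i < j)%N -> u j == v j by move/eqj; rewrite negbK.
case: ltngtP ui => // ui _; apply/orP; [left|right]; apply/existsP; exists i;
  by rewrite ui; apply/forallP=> j; apply/implyP=> /eqj'; rewrite // eq_sym.
Qed.

Lemma rlex_gtD2r t u v : rlex_gt (u + t)%MM (v + t)%MM = rlex_gt u v.
Proof.
apply/rlex_gtP/rlex_gtP; rewrite !mdegD ltn_add2r => -[uv|]; try by left.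
  case=> /addIn uv [i [ui eqj]]; right; split=> //; exists i.
  move: ui; rewrite !mnmDE ltn_add2r; split=> // j /eqj; rewrite !mnmDE.
  exact: addIn.
case=> uv [i [ui eqj]]; right; split; rewrite ?uv //; exists i.
by rewrite !mnmDE ltn_add2r; split=> // j /eqj; rewrite !mnmDE => ->.
Qed.

End MonomialOrders.

(** * The order on the monomials of [T] *)

Section PairOrder.

Variables n m : nat.
Implicit Types z : ('X_{1..n} * 'X_{1..m})%type.

Definition pair_add z z' := ((z.1 + z'.1)%MM, (z.2 + z'.2)%MM).

Lemma xy_gt_irr z : xy_gt z z = false.
Proof. by rewrite /xy_gt rlex_gt_irr lex_gt_irr andbF. Qed.

Lemma xy_gt_trans : transitive (@xy_gt n m).
Proof.
move=> [v v'] [u u'] [t t']; rewrite /xy_gt /= => /orP[uv|/andP[/eqP-> uv]].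
  by case/orP=> [vt|/andP[/eqP<- _]]; rewrite ?uv // (rlex_gt_trans uv vt).
case/orP=> [->//|/andP[/eqP<- vt]].
by rewrite eqxx (lex_gt_trans uv vt) orbT.
Qed.

Lemma xy_gt_total z z' : z != z' -> xy_gt z z' || xy_gt z' z.
Proof.
case: z z' => [u u'] [v v']; rewrite /xy_gt xpair_eqE negb_and /= (eq_sym v').
have [->|/rlex_gt_total/orP[->|->] _] := eqVneq u' v'; rewrite ?orbT //.
by rewrite orbF rlex_gt_irr => /lex_gt_total.
Qed.

Lemma xy_gt_asym z z' : xy_gt z z' -> xy_gt z' z = false.
Proof. by move=> zz'; apply/negP=> /(xy_gt_trans zz'); rewrite xy_gt_irr. Qed.

Lemma xy_gtD2r t z z' : xy_gt (pair_add z t) (pair_add z' t) = xy_gt z z'.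
Proof. by rewrite /xy_gt /= rlex_gtD2r lex_gtD2r eqm_add2r. Qed.

(** [P] carries no decision procedure, so the sublist of [s] is selected by classical case
    analysis. *)
Lemma list_of_bounded_prop (T : eqType) (s : seq T) (P : T -> Prop) :
  (forall x, P x -> x \in s) -> exists2 l, uniq l & forall x, x \in l <-> P x.
Proof.
move=> Ps; suff [l lE] : exists l : seq T, forall x, x \in l <-> x \in s /\ P x.
  exists (undup l); rewrite ?undup_uniq // => x; rewrite mem_undup lE.
  by split=> [[]|Px] //; split=> //; apply: Ps.
elim: s {Ps} => [|y s [l lE]]; first by exists [::] => x; split=> // -[].
have [Py|nPy] := classic (P y); [exists (y :: l)|exists l] => x; rewrite !inE.
  split=> [/orP[/eqP->|/lE[-> ?]]|[/orP[->//|xs] Px]]; rewrite ?eqxx ?orbT //.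
  by apply/orP; right; apply/lE.
rewrite lE; split=> [[-> ?]|[/orP[/eqP->|//]]]; rewrite ?orbT //.
Qed.

Lemma sorted_listing (P : 'X_{1..n} * 'X_{1..m} -> Prop) (N : nat) :
  (forall z, P z -> (mdeg z.1 <= N)%N /\ (mdeg z.2 <= N)%N) ->
  exists zs, [/\ uniq zs, forall z, z \in zs <-> P z
    & forall z0 i j, (i < j < size zs)%N -> xy_gt (nth z0 zs j) (nth z0 zs i)].
Proof.
move=> Pbd.
have [|l ul lP] := @list_of_bounded_prop _
    [seq (bmnm u, bmnm v) | u <- enum {: 'X_{1..n < N.+1}},
                              v <- enum {: 'X_{1..m < N.+1}}] P.
  move=> [u v] /Pbd[/= uN vN]; apply/allpairsP.
  by exists (@BMultinom n N.+1 u uN, @BMultinom m N.+1 v vN); rewrite !mem_enum.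
pose le := fun z z' : 'X_{1..n} * 'X_{1..m} => ~~ xy_gt z z'.
have le_trans : transitive le.
  move=> y x z; rewrite /le => xy yz; apply/negP=> xz.
  have [xyE|nxy] := eqVneq x y; first by rewrite -xyE xz in yz.
  have := xy_gt_total nxy; rewrite (negbTE xy) /= => yx.
  by rewrite (xy_gt_trans yx xz) in yz.
have le_total : total le.
  move=> x y; rewrite /le -negb_and; apply/negP=> /andP[xy].
  by rewrite (xy_gt_asym xy).
exists (sort le l); split=> [|z|z0 i j /andP[ij jl]]; rewrite ?sort_uniq ?mem_sort //.
have := sorted_ltn_nth le_trans z0 (sort_sorted le_total l).
move/(_ i j (ltn_trans ij jl) jl ij) => leij.
have := @xy_gt_total (nth z0 (sort le l) i) (nth z0 (sort le l) j).
rewrite nth_uniq ?sort_uniq // ?(ltn_trans ij jl) // (ltn_eqF ij) => /(_ isT).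
by rewrite (negbTE leij).
Qed.

End PairOrder.

(** * Subalgebras of [S[t]] generated by monomials *)

Section MonomialAlgebra.

Variables (K : fieldType) (n m : nat) (w : 'I_m -> 'X_{1..n} * nat).
Local Notation S := {mpoly K[n]}.
Local Notation mon := ('X_{1..n} * 'X_{1..m})%type.
Implicit Types (u : 'X_{1..n}) (b : 'X_{1..m}) (z : mon).

(** The presentation sends [y^b] to [x^(xpart b) t^(tpart b)]. *)
Definition xpart b : 'X_{1..n} := (\sum_i (w i).1 *+ b i)%MM.
Definition tpart b : nat := (\sum_i (w i).2 * b i)%N.
Definition image_mon z : 'X_{1..n} * nat := ((z.1 + xpart z.2)%MM, tpart z.2).

Lemma xpart0 : xpart 0 = 0%MM.
Proof. by apply: big1 => i _; rewrite mnm0E mulm0n. Qed.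

Lemma xpartD : {morph xpart : b b' / (b + b')%MM}.
Proof.
move=> b b'; rewrite -big_split; apply: eq_bigr => i _; apply/mnmP=> j.
by rewrite [RHS]mnmDE !mulmnE mnmDE mulnDr.
Qed.

Lemma xpart1 i : xpart U_(i) = (w i).1.
Proof.
rewrite /xpart (bigD1 i) //= mnm1E eqxx mulm1n big1 ?addm0 // => j ji.
by rewrite mnm1E eq_sym (negbTE ji).
Qed.

Lemma tpart0 : tpart 0 = 0%N.
Proof. by apply: big1 => i _; rewrite mnm0E muln0. Qed.

Lemma tpartD : {morph tpart : b b' / (b + b')%MM >-> (b + b')%N}.
Proof.
by move=> b b'; rewrite -big_split; apply: eq_bigr => i _; rewrite mnmDE mulnDr.
Qed.

Lemma tpart1 i : tpart U_(i) = (w i).2.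
Proof.
rewrite /tpart (bigD1 i) //= mnm1E eqxx muln1 big1 ?addn0 // => j ji.
by rewrite mnm1E eq_sym (negbTE ji) muln0.
Qed.

Lemma tmonD u v k l : tmon K ((u + v)%MM, (k + l)%N) = tmon K (u, k) * tmon K (v, l).
Proof. by rewrite /tmon /= mpolyXD polyCM exprD mulrACA. Qed.

Lemma tmon0 : tmon K (0%MM : 'X_{1..n}, 0%N) = 1.
Proof. by rewrite /tmon mpolyX0 expr0 mulr1. Qed.

Lemma tmonX (z : 'X_{1..n} * nat) a : tmon K ((z.1 *+ a)%MM, (z.2 * a)%N) = tmon K z ^+ a.
Proof.
case: z => u k /=; elim: a => [|a IHa]; first by rewrite mulm0n muln0 tmon0.
by rewrite mulmS mulnS tmonD IHa exprS.
Qed.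

Lemma tmon_xpart b : tmon K (xpart b, tpart b) = \prod_i tmon K (w i) ^+ b i.
Proof.
rewrite /xpart /tpart; elim: (index_enum _) => [|i s IHs].
  by rewrite !big_nil tmon0.
by rewrite !big_cons tmonD IHs tmonX.
Qed.

Lemma tmon_image z :
  tmon K (image_mon z) = ('X_[z.1])%:P * \prod_i tmon K (w i) ^+ z.2 i.
Proof. by rewrite -tmon_xpart /image_mon -[in LHS](add0n (tpart _)) tmonD /tmon expr0 mulr1. Qed.

Lemma coef_tmon (z : 'X_{1..n} * nat) u k : (tmon K z)`_k@_u = (z == (u, k))%:R.
Proof.
case: z => v l; rewrite /tmon coefCM coefXn xpair_eqE /= (eq_sym k).
by case: (l == k); rewrite ?mulr1 ?mulr0 ?mcoeffX ?mcoeff0 ?andbT ?andbF.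
Qed.

Lemma msupp_tmon (z : 'X_{1..n} * nat) u k :
  (u \in msupp (tmon K z)`_k) = (z == (u, k)).
Proof. by rewrite mcoeff_msupp coef_tmon; case: (z == _); rewrite ?oner_eq0 ?eqxx. Qed.

(** Restricting to a subset [J] of the generators lets a presentation of [w i] that avoids [w i]
    contradict minimality. *)
Lemma tmon_in_algebra_gen (J : pred 'I_m) z : (forall i, ~~ J i -> z.2 i = 0%N) ->
  algebra_gen (fun q => exists2 j, J j & q = tmon K (w j)) (tmon K (image_mon z)).
Proof.
move=> zJ B [BC _ BM] Bw; rewrite tmon_image; apply: (BM) => //.
have B1 : B 1 by have:= BC 1; rewrite polyC1.
apply: (big_ind B) => // i _; have [Ji|/zJ->] := boolP (J i); last by rewrite expr0.
elim: (z.2 i) => [|a IHa]; rewrite ?expr0 ?exprS //.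
by apply: (BM) => //; apply: Bw; exists i.
Qed.

(** The polynomials all of whose monomials are images form a subalgebra containing the
    generators. *)
Lemma algebra_gen_supp p : algebra_gen (fun q => exists i, q = tmon K (w i)) p ->
  forall k u, u \in msupp p`_k -> exists z, image_mon z = (u, k).
Proof.
pose B (f : {poly S}) := forall k u, u \in msupp f`_k -> exists z, image_mon z = (u, k).
move/(_ B); apply=> [|_ [i ->] k u]; last first.
  rewrite msupp_tmon => /eqP wE.
  by exists (0%MM, U_(i)%MM); rewrite /image_mon xpart1 tpart1 add0m -wE; case: (w i).
split.
- move=> c k u; rewrite coefC; case: eqP => [-> _|_]; last by rewrite msupp0.
  by exists (u, 0%MM); rewrite /image_mon xpart0 tpart0 addm0.
- move=> f g fB gB k u; rewrite coefD => /msuppD_le; rewrite mem_cat.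
  by case/orP => [/fB|/gB].
- move=> f g fB gB k u; rewrite coefM => /msupp_sum_le.
  case/flattenP=> _ /mapP[i _ ->] /msuppM_le /allpairsP[[x y] /= [/fB[z zE] /gB[z' z'E] ->]].
  exists (pair_add z z'); rewrite /image_mon /= xpartD tpartD.
  case: zE => <- ->; case: z'E => <- ->; rewrite subnKC -1?ltnS //.
  by congr pair; apply/mnmP=> j; rewrite !mnmDE addnACA.
Qed.

End MonomialAlgebra.

(** * Covers and the generators of the symbolic Rees algebra *)

Section Generators.

Variables (K : fieldType) (n r : nat) (F : 'I_r -> {set 'I_n}) (e : 'I_r -> nat).
Variables (I : {mpoly K[n]} -> Prop) (m : nat) (w : 'I_m -> 'X_{1..n} * nat).
Hypothesis hI : minimal_intersection F e I.
Hypothesis hgen : min_monomial_generators (symbolic_rees I) w.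
Implicit Types (u v : 'X_{1..n}) (b : 'X_{1..m}).

Lemma coverD k l u v :
  Defs.cover F e k u -> Defs.cover F e l v -> Defs.cover F e (k + l) (u + v)%MM.
Proof.
move=> ku lv i; rewrite -/(wt _ _) wtD mulnDl.
by apply: leq_add; [apply: ku | apply: lv].
Qed.

Lemma cover_le k u v : Defs.cover F e k u -> (u <= v)%MM -> Defs.cover F e k v.
Proof. by move=> ku uv i; apply: leq_trans (ku i) (wt_le (F i) uv). Qed.

Lemma symbolic_rees_tmon (z : 'X_{1..n} * nat) :
  symbolic_rees I (tmon K z) <-> Defs.cover F e z.2 z.1.
Proof.
split=> [/(_ z.2)/(symbolic_powerE hI)/(_ z.1)|zc k].
  by rewrite msupp_tmon -surjective_pairing eqxx; apply.
apply/(symbolic_powerE hI) => u; rewrite msupp_tmon.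
by move=> /eqP zE; move: zc; rewrite zE.
Qed.

Lemma cover_gen i : Defs.cover F e (w i).2 (w i).1.
Proof.
case: hgen => _ RE _; apply/symbolic_rees_tmon/RE => B _; apply.
by exists i.
Qed.

Lemma cover_image z : Defs.cover F e (tpart w z.2) (z.1 + xpart w z.2)%MM.
Proof.
rewrite -[tpart _ _]add0n; apply: coverD; first by move=> i.
rewrite /tpart /xpart; elim: (index_enum _) => [|i s IHs].
  by rewrite !big_nil => i.
rewrite !big_cons; apply: coverD IHs; elim: (z.2 i) => [|a IHa].
  by rewrite muln0 mulm0n => j.
by rewrite mulnS mulmS; apply: coverD IHa; apply: cover_gen.
Qed.

Lemma cover_decomposition k u :
  Defs.cover F e k u -> exists z, image_mon w z = (u, k).
Proof.
move=> ku; case: hgen => _ RE _.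
have /RE/algebra_gen_supp/(_ k u) := (symbolic_rees_tmon (u, k)).2 ku.
by apply; rewrite msupp_tmon eqxx.
Qed.

(** A generator of [t]-degree 0 would lie in [S], hence in every [S]-subalgebra, against
    minimality. *)
Lemma gen_degree_gt0 i : (0 < (w i).2)%N.
Proof.
rewrite lt0n; apply/negP=> /eqP w0; case: hgen => _ _ /(_ i); apply=> B [BC _ _] _.
by rewrite /tmon w0 expr0 mulr1.
Qed.

(* If neither part of a decomposition involves the generator [w i], then it is
   redundant; if one does, then the other one vanishes. *)
Lemma gen_indecomposable i : indecomposable_cover F e (w i).2 (w i).1.
Proof.
split=> [|[a1 [a2 [p1 [p2 [[a10 a20] /cover_decomposition[z1 z1E]
  /cover_decomposition[z2 z2E] w1E w2E]]]]]]; first exact: cover_gen.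
have noti z a a' p : a' != 0%MM -> (w i).1 = (a + a')%MM ->
    image_mon w z = (a, p) -> z.2 i = 0%N.
  move=> a'0 wE [aE _]; apply/eqP/negPn/negP=> zi; case/negP: a'0; apply/eqP/mnmP=> j.
  have := congr1 (fun u : 'X_{1..n} => u j) wE; rewrite -aE -(@submK _ U_(i)%MM z.2) ?lep1mP //.
  by rewrite xpartD xpart1 !mnmDE mnm0E; lia.
have zi : (pair_add z1 z2).2 i = 0%N.
  rewrite mnmDE (noti _ _ _ _ a20 w1E z1E) (noti _ _ _ _ a10 _ z2E) //.
  by rewrite w1E addmC.
case: hgen => _ _ /(_ i); apply.
have -> : w i = image_mon w (pair_add z1 z2).
  case: z1E z2E => <- <- [a2E p2E] in w1E w2E *.
  rewrite /image_mon /= xpartD tpartD [w i]surjective_pairing w1E w2E -a2E -p2E.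
  by congr pair; apply/mnmP=> j; rewrite !mnmDE addnACA.
by apply: tmon_in_algebra_gen => j; rewrite negbK => /eqP->.
Qed.

Lemma mdeg_tpart b : (mdeg b <= tpart w b)%N.
Proof.
rewrite mdegE; apply: leq_sum => i _; apply: leq_pmull; exact: gen_degree_gt0.
Qed.

(** Each generator is indecomposable of positive [t]-degree, so the linear cover function gives its
    [x]-degree; counted with multiplicity, the constants add up to [d * mdeg b]. *)
Lemma mdeg_xpart c d b :
  (forall k a, (0 < k)%N -> indecomposable_cover F e k a -> mdeg a = (c * k + d)%N) ->
  mdeg (xpart w b) = (c * tpart w b + d * mdeg b)%N.
Proof.
move=> lin; rewrite mdeg_sum mdegE !big_distrr -big_split; apply: eq_bigr => i _ /=.
by rewrite mdegMn (lin _ _ (gen_degree_gt0 i) (gen_indecomposable i)) mulnDl mulnA.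
Qed.

End Generators.

(** * The initial ideal of the toric ideal *)

Section InitialIdeal.

Variables (K : fieldType) (n m : nat) (w : 'I_m -> 'X_{1..n} * nat).
Local Notation T := {mpoly {mpoly K[n]}[m]}.
Local Notation mon := ('X_{1..n} * 'X_{1..m})%type.
Local Notation gt := (@xy_gt n m).
Implicit Types (z : mon) (p q : T).

Definition mon_le z z' := (z.1 <= z'.1)%MM && (z.2 <= z'.2)%MM.

Lemma mon_le_trans : transitive mon_le.
Proof.
move=> y x z /andP[xy1 xy2] /andP[yz1 yz2].
by rewrite /mon_le (lepm_trans xy1 yz1) (lepm_trans xy2 yz2).
Qed.

(* [z] is the initial monomial of a binomial of the toric ideal. *)
Definition reducible z := exists2 z', image_mon w z' = image_mon w z & gt z z'.

Lemma image_monD z t :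
  image_mon w (pair_add z t) =
  (((image_mon w z).1 + (image_mon w t).1)%MM, ((image_mon w z).2 + (image_mon w t).2)%N).
Proof.
rewrite /image_mon /= xpartD tpartD; congr pair.
by apply/mnmP=> j; rewrite !mnmDE addnACA.
Qed.

Lemma reducible_le z z' : mon_le z z' -> reducible z -> reducible z'.
Proof.
case/andP=> le1 le2 [y yE zy]; pose t := ((z'.1 - z.1)%MM, (z'.2 - z.2)%MM).
have z'E : z' = pair_add z t.
  by rewrite /pair_add /= addmC (submK le1) addmC (submK le2); case: z' {le1 le2 t}.
by exists (pair_add y t); rewrite z'E ?xy_gtD2r // !image_monD yE.
Qed.

Lemma xy_coeff_xymon z z' : xy_coeff (xymon K z) z' = (z == z')%:R.
Proof.
case: z z' => u v [u' v']; rewrite /xy_coeff /xymon mcoeffZ mcoeffX xpair_eqE /=.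
by case: (v == v'); rewrite ?mulr1 ?mulr0 ?mcoeffX ?mcoeff0 ?andbT ?andbF.
Qed.

Lemma xy_coeffB p q z : xy_coeff (p - q) z = xy_coeff p z - xy_coeff q z.
Proof. by rewrite /xy_coeff !mcoeffB. Qed.

Lemma presentation_map_xymon z : presentation_map w (xymon K z) = tmon K (image_mon w z).
Proof. by rewrite tmon_image /presentation_map /xymon mmapZ mmapX. Qed.

Lemma reducible_initial z :
  reducible z -> initial_ideal gt (presentation_ideal (K := K) w) (xymon K z).
Proof.
case=> z' z'E zz'; apply: ideal_gen_mem; exists (xymon K z - xymon K z'), z.
have z'z : z' != z by apply: contraTneq zz' => ->; rewrite xy_gt_irr.
split=> //.
  rewrite /presentation_ideal /presentation_map mmapB -!/(presentation_map w _).
  by rewrite !presentation_map_xymon z'E subrr.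
split=> [|y]; rewrite xy_coeffB !xy_coeff_xymon.
  by rewrite eqxx (negbTE z'z) subr0 oner_eq0.
move=> yc yz; move: yc; rewrite (eq_sym z) (negbTE yz) sub0r oppr_eq0.
by have [<-|] := eqVneq z' y; rewrite ?eqxx.
Qed.

Lemma coef_presentation_map p k u :
  (presentation_map w p)`_k@_u =
  \sum_(v <- msupp p) \sum_(t <- msupp p@_v)
     xy_coeff p (t, v) * (image_mon w (t, v) == (u, k))%:R.
Proof.
rewrite /presentation_map /mmap coef_sum raddf_sum; apply: eq_bigr => v _ /=.
have -> : (p@_v)%:P * mmap1 (fun i => tmon K (w i)) v =
    \sum_(t <- msupp p@_v) (xy_coeff p (t, v) *: 'X_[t])%:P * mmap1 (fun i => tmon K (w i)) v.
  by rewrite -mulr_suml {1}[p@_v]mpolyE raddf_sum.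
rewrite coef_sum raddf_sum; apply: eq_bigr => t _ /=.
rewrite -mul_mpolyC polyCM -mulrA -(tmon_image K w (t, v)) coefCM.
by rewrite mcoeffCM coef_tmon.
Qed.

(** If [z] were not reducible, no other term of [p], being smaller, could share its image, and the
    coefficient of [presentation_map w p] there would be the nonzero coefficient of [z]. *)
Lemma initial_reducible p z :
  presentation_ideal w p -> is_initial gt p z -> reducible z.
Proof.
move=> pJ [pz zmax]; apply: NNPP => nred.
have uniq_im y : xy_coeff p y != 0 -> image_mon w y = image_mon w z -> y = z.
  move=> py yz; apply/eqP/negPn/negP=> ynz; apply: nred.
  by exists y; rewrite ?zmax.
have := coef_presentation_map p (image_mon w z).2 (image_mon w z).1.
rewrite pJ coef0 mcoeff0 => /esym/eqP; apply/negP.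
have zv : z.2 \in msupp p.
  by rewrite mcoeff_msupp; apply: contraNneq pz => p0; rewrite /xy_coeff p0 mcoeff0.
have zt : z.1 \in msupp p@_z.2 by rewrite mcoeff_msupp.
have term0 y : y != z ->
    xy_coeff p y * (image_mon w y == ((image_mon w z).1, (image_mon w z).2))%:R = 0.
  move=> yz; case: eqP => [yE|_]; last by rewrite mulr0.
  rewrite mulr1; apply/eqP; apply: contraNT yz => /uniq_im->//.
rewrite (bigD1_seq z.2) ?msupp_uniq //= (bigD1_seq z.1) ?msupp_uniq //=.
rewrite -!surjective_pairing eqxx mulr1 big1 ?addr0; last first.
  by move=> t tz; apply: term0; rewrite [z]surjective_pairing xpair_eqE (negbTE tz).
rewrite big1 ?addr0 // => v vz; apply: big1 => t _; apply: term0.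
by rewrite [z]surjective_pairing xpair_eqE (negbTE vz) andbF.
Qed.

Lemma xy_coeffM_neq0 p q z : xy_coeff (p * q) z != 0 ->
  exists2 z', xy_coeff q z' != 0 & mon_le z' z.
Proof.
rewrite /xy_coeff mcoeffM -mcoeff_msupp => /msupp_sum_le /flattenP[x /mapP[[k1 k2]]].
rewrite mem_filter => /andP[/= /eqP zE _] -> /msuppM_le /allpairsP[[a b] /= [_ bq abE]].
exists (b, bmnm k2); first by rewrite -mcoeff_msupp.
by rewrite /mon_le /= abE lem_addl /= [X in (_ <= X)%MM]zE lem_addl.
Qed.

(** Initial monomials of elements of the toric ideal are reducible, and the polynomials whose terms
    all have reducible divisors form an ideal. *)
Lemma initial_ideal_divisible z :
  initial_ideal gt (presentation_ideal (K := K) w) (xymon K z) ->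
  exists2 z', reducible z' & mon_le z' z.
Proof.
pose L (p : T) := forall z, xy_coeff p z != 0 -> exists2 z', reducible z' & mon_le z' z.
move=> zin; suff /(_ z) : L (xymon K z).
  by apply; rewrite xy_coeff_xymon eqxx oner_eq0.
move: zin; apply: ideal_gen_sub => [|q [p [y [pJ py ->]]] x].
  split=> [y|p q Lp Lq y|p q Lq y].
  - by rewrite /xy_coeff !mcoeff0 eqxx.
  - rewrite /xy_coeff !mcoeffD -!/(xy_coeff _ y) => py.
    have [p0|/Lp//] := eqVneq (xy_coeff p y) 0.
    by apply: Lq; move: py; rewrite p0 add0r.
  - case/xy_coeffM_neq0=> y' /Lq[y'' ry le1] le2; exists y'' => //.
    exact: mon_le_trans le1 le2.
rewrite xy_coeff_xymon; have [<- _|] := eqVneq y x; last by rewrite eqxx.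
by exists y; [apply: initial_reducible py | rewrite /mon_le !lepm_refl].
Qed.

(** Descent through proper reducible divisors, by induction on the total degree, ends at a minimal
    generator of the initial ideal, where the [x]-condition applies. *)
Lemma reducible_x_linear z :
  x_condition gt (presentation_ideal (K := K) w) -> reducible z ->
  exists2 y, reducible y & mon_le y z /\ (mdeg y.1 <= 1)%N.
Proof.
move=> hx; have [N] := ubnP (mdeg z.1 + mdeg z.2)%N; elim: N z => // N IHN z zN rz.
pose L := initial_ideal gt (presentation_ideal (K := K) w).
have [zmin | nmin] := classic (min_xymon_gen L z).
  by exists z => //; split; [rewrite /mon_le !lepm_refl | apply: hx].
have [z' [rz' z'z z'nz]] : exists z', [/\ reducible z', mon_le z' z & z' != z].
  apply: NNPP => H; apply: nmin; split; first exact: reducible_initial.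
  move=> z' /initial_ideal_divisible[y ry yz'] le1 le2.
  have z'z : mon_le z' z by rewrite /mon_le le1.
  have yz : y = z.
    by apply: NNPP => /eqP ynz; apply: H; exists y; rewrite (mon_le_trans yz').
  have /andP[le3 le4] := yz'; rewrite yz in le3 le4.
  rewrite [z']surjective_pairing [z]surjective_pairing; congr pair;
    apply/mnmP=> j; apply/eqP; rewrite eqn_leq; apply/andP; split; exact: mnm_lepP.
have [/andP[le1 le2]] := z'z.
have [|y ry [yz' y1]] := IHN z' _ rz'; last first.
  by exists y => //; rewrite (mon_le_trans yz' z'z).
have e1 := mdegD (z.1 - z'.1)%MM z'.1; rewrite (submK le1) in e1.
have e2 := mdegD (z.2 - z'.2)%MM z'.2; rewrite (submK le2) in e2.
suff: (0 < mdeg (z.1 - z'.1) + mdeg (z.2 - z'.2))%N by lia.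
rewrite lt0n addn_eq0 !mdeg_eq0; apply: contraNN z'nz => /andP[/eqP d1 /eqP d2].
rewrite [z]surjective_pairing [z']surjective_pairing -(submK le1) -(submK le2).
by rewrite d1 d2 !add0m.
Qed.

End InitialIdeal.

(** * Standard monomials and the exchange property *)

Section StandardMonomials.

Variables (K : fieldType) (n r : nat) (F : 'I_r -> {set 'I_n}) (e : 'I_r -> nat).
Variables (I : {mpoly K[n]} -> Prop) (m : nat) (w : 'I_m -> 'X_{1..n} * nat).
Hypothesis hI : minimal_intersection F e I.
Hypothesis hlin : linear_cover_function F e.
Hypothesis hgen : min_monomial_generators (symbolic_rees I) w.
Hypothesis hx : x_condition (@xy_gt n m) (presentation_ideal (K := K) w).
Local Notation mon := ('X_{1..n} * 'X_{1..m})%type.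
Local Notation gt := (@xy_gt n m).
Local Notation xmon z := (image_mon w z).1.
Implicit Types (z : mon) (u v : 'X_{1..n}) (b : 'X_{1..m}).

Definition standard z := ~ reducible w z.

(** Of two distinct monomials with the same image, the larger is reducible. *)
Lemma standard_inj z z' :
  standard z -> standard z' -> image_mon w z = image_mon w z' -> z = z'.
Proof.
move=> sz sz' zz'; apply/eqP/negPn/negP=> /xy_gt_total/orP[gt_zz'|gt_z'z].
  by apply: sz; exists z'.
by apply: sz'; exists z.
Qed.

Lemma eq_mdeg_le u v : (u <= v)%MM -> (mdeg v <= mdeg u)%N -> u = v.
Proof.
move=> uv; have := mdegD (v - u)%MM u; rewrite (submK uv) => -> le.
have /eqP : mdeg (v - u)%MM = 0%N by lia.
by rewrite mdeg_eq0 => /eqP vu; rewrite -(submK uv) vu add0m.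
Qed.

(** The generators have positive [t]-degree, so only finitely many monomials share an image; the
    least of them is standard. *)
Lemma standard_exists z : exists z0,
  [/\ standard z0, image_mon w z0 = image_mon w z & z0 = z \/ gt z z0].
Proof.
pose P y := image_mon w y = image_mon w z.
have [y yE|zs [_ zsP zs_lt]] :=
    @sorted_listing n m P (mdeg (xmon z) + tpart w z.2)%N.
  have := mdeg_tpart hgen y.2; have := congr1 (fun q => mdeg q.1) yE.
  by have := congr1 snd yE; rewrite /= !mdegD => ->; lia.
case: zs zsP zs_lt => [|z0 zs] zsP zs_lt.
  by have /zsP := erefl (image_mon w z).
have z0P : P z0 by apply/zsP; rewrite mem_head.
have z0min y : P y -> y = z0 \/ gt y z0.
  move=> /zsP; rewrite in_cons => /orP[/eqP->|ys]; first by left.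
  have := zs_lt z0 0%N (index y (z0 :: zs)); rewrite nth_index ?in_cons ?ys ?orbT //.
  rewrite index_mem in_cons ys orbT andbT /=; case: eqP => [z0y _|_ /(_ isT)]; last by right.
  by left.
exists z0; split=> //; last first.
  by have [//|->|] := z0min z; [left|right].
case=> y yE z0y; case: (z0min y); first by rewrite /P yE.
  by move=> yz0; rewrite yz0 xy_gt_irr in z0y.
by rewrite (xy_gt_asym z0y).
Qed.

Lemma xmon_mdeg : exists c d, forall z,
  mdeg (xmon z) = (mdeg z.1 + c * tpart w z.2 + d * mdeg z.2)%N.
Proof.
case: hlin => c [d lin]; exists c, d => z.
by rewrite /image_mon /= mdegD (mdeg_xpart hI hgen z.2 lin) addnA.
Qed.

(* The lcm of [x^a] and [x^a'] has two presentations, the larger of which is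
   divisible by a reducible monomial [x_l y^v]; the [x]-condition and the
   standardness of [z] force [x_l] to divide [lcm / x^a]. *)
Lemma standard_exchange z z' :
  standard z -> tpart w z.2 = tpart w z'.2 -> rlex_gt z.2 z'.2 ->
  exists l h b,
    [/\ (xmon z l < xmon z' l)%N, rlex_gt z.2 b, tpart w b = tpart w z.2
      & (U_(l) + xpart w z.2 = h + xpart w b)%MM].
Proof.
move=> sz zz't gt_zz'; set a := xmon z; set a' := xmon z'.
(* Subtraction of exponents is truncated, so [a' - a] is the exponent of [lcm / x^a], and both
   monomials map to the lcm with the same power of [t]. *)
pose y := ((a' - a + z.1)%MM, z.2); pose y' := ((a - a' + z'.1)%MM, z'.2).
have yy' : image_mon w y' = image_mon w y.
  rewrite /image_mon /= zz't; congr pair; apply/mnmP=> j.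
  by rewrite /y /y' /= !mnmDE !mnmBE !mnmDE; lia.
have [|[x v] ry [/andP[/= xy vy] x1]] := @reducible_x_linear K n m w y hx.
  by exists y' => //; rewrite /xy_gt gt_zz'.
have [x0 | xl] : x = 0%MM \/ exists l, x = U_(l)%MM.
  case: (posnP (mdeg x)) => [/eqP|x_gt0]; first by rewrite mdeg_eq0 => /eqP; left.
  have /mdeg1P[l /eqP] : mdeg x == 1%N by rewrite eqn_leq x1.
  by right; exists l.
  case: sz; apply: reducible_le ry.
  by rewrite /mon_le /= x0 vy andbT; apply/mnm_lepP=> j; rewrite mnm0E.
case: xl => l xl; subst x.
have zl : z.1 l = 0%N.
  apply/eqP/negPn/negP=> zl; case: sz; apply: reducible_le ry.
  by rewrite /mon_le /= vy lep1mP zl.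
have al : (a l < a' l)%N.
  by move: xy; rewrite lep1mP mnmDE mnmBE zl addn0 -lt0n subn_gt0.
case: ry => -[h v'] ryE; have /= hE := congr1 fst ryE; have /= vt := congr1 snd ryE.
(* Equal [y]-parts would force equal [x]-parts through the common image, so the strict drop happens
   in the [y]-part. *)
rewrite /xy_gt /= => /orP[vv' | /andP[/eqP vv' hl]]; last first.
  move: hE hl; rewrite -vv' => /addIm->; by rewrite lex_gt_irr.
exists l, h, (v' + (z.2 - v))%MM; split=> //.
- by rewrite -{1}(submK vy) addmC rlex_gtD2r.
- by rewrite tpartD vt -tpartD addmC submK.
- by rewrite xpartD addmA hE -addmA -xpartD [(v + _)%MM]addmC submK.
Qed.

(** The list runs upwards in the order on [T], so a smaller element [z''] of [P] stands at an
    earlier index; this turns an exchange inside [P] into [linear_exchange]. *)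
Lemma linear_exchange_listing (P : mon -> Prop) (N : nat) :
  (forall z, P z -> (mdeg z.1 <= N)%N /\ (mdeg z.2 <= N)%N) ->
  (forall z z', P z -> P z' -> xmon z = xmon z' -> z = z') ->
  (forall z z', P z -> P z' -> gt z z' -> exists l z'',
     [/\ P z'', gt z z'', (xmon z l < xmon z' l)%N
       & (xmon z'' <= xmon z + U_(l))%MM]) ->
  exists us, [/\ uniq us, forall u, u \in us <-> exists2 z, P z & xmon z = u
    & linear_exchange us].
Proof.
move=> /sorted_listing[zs [uzs zsP zs_lt]] Pinj Pex.
exists [seq xmon z | z <- zs]; split.
- by rewrite map_inj_in_uniq // => z z' /zsP Pz /zsP; apply: Pinj.
- move=> u; split=> [/mapP[z /zsP Pz ->]|[z /zsP z_zs <-]]; first by exists z.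
  exact: map_f.
move=> i j /andP[ji]; rewrite size_map => i_zs.
pose z0 : mon := (0%MM, 0%MM); pose z := nth z0 zs i; pose z' := nth z0 zs j.
have Pz : P z by apply/zsP; rewrite mem_nth.
have Pz' : P z' by apply/zsP; rewrite mem_nth // (ltn_trans ji).
have [|l [z'' [/zsP Pz'' zz'' ltl le_z'']]] := Pex z z' Pz Pz'.
  by apply: zs_lt; rewrite ji.
have lt_z'' : (index z'' zs < i)%N.
  rewrite ltnNge leq_eqVlt; apply/negP=> /orP[/eqP ei|lt_i].
    by move: zz''; rewrite /z ei nth_index // xy_gt_irr.
  have := zs_lt z0 i (index z'' zs); rewrite lt_i index_mem Pz'' nth_index //.
  by move=> /(_ isT); rewrite (xy_gt_asym zz'').
exists l, (index z'' zs).
rewrite !(nth_map z0) ?(ltn_trans ji) ?index_mem // nth_index //.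
Qed.

Lemma cover_min k u : Defs.cover F e k u ->
  exists v, [/\ Defs.cover F e k v, (v <= u)%MM &
    forall v', Defs.cover F e k v' -> (v' <= v)%MM -> v' = v].
Proof.
have [N] := ubnP (mdeg u); elim: N u => // N IHN u uN ku.
have [umin | nmin] := classic (forall v', Defs.cover F e k v' -> (v' <= u)%MM -> v' = u).
  by exists u; split; rewrite ?lepm_refl.
have [v [kv vu vnu]] : exists v, [/\ Defs.cover F e k v, (v <= u)%MM & v <> u].
  by apply: NNPP => H; apply: nmin => v kv vu; apply: NNPP => vnu; apply: H; exists v.
have [|v0 [kv0 v0v v0min]] := IHN v _ kv.
  rewrite -ltnS; apply: leq_trans uN; rewrite ltnS ltnNge; apply/negP=> le; apply: vnu.
  exact: eq_mdeg_le.
by exists v0; split=> //; apply: lepm_trans v0v vu.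
Qed.

Lemma min_mon_genE k u : min_mon_gen (symbolic_power I k) u <->
  Defs.cover F e k u /\ forall v, Defs.cover F e k v -> (v <= u)%MM -> v = u.
Proof.
have symX v : symbolic_power I k 'X_[v] <-> Defs.cover F e k v.
  by rewrite (symbolic_powerE hI) supp_idealX.
rewrite /min_mon_gen symX; split=> -[ku umin]; split=> // v kv; apply: umin;
  exact/symX.
Qed.

(** The exchange yields a cover [xpart b] that may fail to be minimal; the earlier generator is
    taken to be a minimal cover [v] below it, and must be shown to precede [z]. *)
Lemma symbolic_power_linear_quotients k : linear_quotients (symbolic_power I k).
Proof.
have [c [d degE]] := xmon_mdeg.
have coverE z : tpart w z.2 = k -> Defs.cover F e k (xmon z).
  by move<-; apply: cover_image hI hgen _.
pose P z := [/\ standard z, tpart w z.2 = k & min_mon_gen (symbolic_power I k) (xmon z)].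
(* Dropping [z.1] leaves a [k]-cover below a minimal one, so [z.1] is trivial. *)
have z1_0 z : tpart w z.2 = k -> min_mon_gen (symbolic_power I k) (xmon z) -> z.1 = 0%MM.
  move=> zk /min_mon_genE[_ zmin].
  have := zmin _ (coverE (0%MM, z.2) zk); rewrite /= add0m lem_addl => /(_ isT).
  by move=> /esym/eqP; rewrite -[X in _ == X]add0m eqm_add2r => /eqP.
have [z [sz zk zmin]|z z' [sz zk _] [sz' z'k _] zz'|z z' Pz Pz' gt_zz'|us [uus usP lus]] :=
    @linear_exchange_listing P k.
- by rewrite (z1_0 z) // mdeg0 -zk (mdeg_tpart hgen).
- apply: standard_inj => //; rewrite [LHS]surjective_pairing [RHS]surjective_pairing.
  by rewrite zz' /= zk z'k.
- have [sz zk zmin] := Pz; have [_ z'k z'min] := Pz'.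
  have gt2 : rlex_gt z.2 z'.2.
    case/orP: gt_zz' => // /andP[_]; rewrite (z1_0 z) // (z1_0 z') //.
    by rewrite lex_gt_irr.
  have [|l [h [b [ltl gtb bk lE]]]] := standard_exchange sz _ gt2; first by rewrite zk.
  have kb : Defs.cover F e k (xpart w b).
    by have := coverE (0%MM, b); rewrite /= add0m; apply; rewrite bk.
  have [v [kv vb vmin]] := cover_min kb.
  have [y yE] := cover_decomposition hI hgen kv.
  have [z'' [sz'' z''E _]] := standard_exists y; rewrite yE in z''E.
  have [z''v z''k] : xmon z'' = v /\ tpart w z''.2 = k by rewrite z''E; case: z''E.
  have z''min : min_mon_gen (symbolic_power I k) (xmon z'').
    by rewrite z''v; apply/min_mon_genE.
  have z''10 := z1_0 _ z''k z''min.
  exists l, z''; split=> //; last first.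
    rewrite z''v; apply: (lepm_trans vb); apply: (lepm_trans (lem_addl h _)).
    by rewrite -lE /= (z1_0 z) // add0m addmC lepm_refl.
  (* Either [xpart w b] is itself minimal, and passing to the standard monomial can only go down; or
     the degree drops, which by the affine degree formula means fewer [y]-factors. *)
  have [vbE | vnb] := eqVneq v (xpart w b).
    have [y0 [sy0 y0E y0b]] := standard_exists (0%MM, b).
    have -> : z'' = y0.
      by apply: standard_inj => //; rewrite y0E z''E /image_mon /= add0m vbE bk zk.
    have gt_b : gt z (0%MM, b) by rewrite /xy_gt gtb.
    by case: y0b => [->//|]; apply: xy_gt_trans.
  have ltd : (mdeg v < mdeg (xpart w b))%N.
    by rewrite ltnNge; apply: contraNN vnb => /(eq_mdeg_le vb) ->.
  rewrite /xy_gt; apply/orP; left; apply/rlex_gtP; left.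
  apply: leq_trans (rlex_gt_mdeg gtb).
  have := degE z''; have := degE (0%MM, b); rewrite z''v z''10 /= add0m mdeg0.
  rewrite z''k bk zk => eb ev; rewrite ltnNge; apply/negP=> le.
  have : (d * mdeg b <= d * mdeg z''.2)%N by rewrite leq_mul2l le orbT.
  by lia.
have us_gen u : u \in us <-> min_mon_gen (symbolic_power I k) u.
  rewrite usP; split=> [[z [_ _ zmin] <-]//|umin].
  have /min_mon_genE[/(cover_decomposition hI hgen)[y yE] _] := umin.
  have [z [sz zE _]] := standard_exists y; rewrite yE in zE.
  have [zx zk] : xmon z = u /\ tpart w z.2 = k by rewrite zE; case: zE.
  by exists z => //; split; rewrite ?zx.
exists us; split=> // [f|i /andP[_ i_us]].
  rewrite (symbolic_powerE hI) monomial_spanE; split=> fk u /fk.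
    case/cover_min=> v [kv vu vmin]; exists v => //.
    by apply/us_gen/min_mon_genE.
  by case=> v /us_gen/min_mon_genE[kv _]; apply: cover_le.
have [V VE] := linear_exchange_colon K lus i_us.
by exists V => f; rewrite colon_monomial VE.
Qed.

(** All monomials of degree [D] in the symbolic power are listed by their standard monomials; the
    exchange must now stay in degree [D]. *)
Lemma symbolic_power_componentwise_linear k :
  componentwise_linear (symbolic_power I k).
Proof.
move=> D; exists D; have [c [d degE]] := xmon_mdeg.
pose P z := [/\ standard z, tpart w z.2 = k & mdeg (xmon z) = D].
have [z [sz zk zD]|z z' [sz zk _] [sz' z'k _] zz'|z z' Pz Pz' gt_zz'|us [uus usP lus]] :=
    @linear_exchange_listing P (k + D).
- have := mdeg_tpart hgen z.2; move: zD; rewrite /= mdegD zk; lia.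
- apply: standard_inj => //; rewrite [LHS]surjective_pairing [RHS]surjective_pairing.
  by rewrite zz' /= zk z'k.
- have [sz zk zD] := Pz; have [_ z'k z'D] := Pz'.
  (* Any such monomial [y] will do, since the standard one with the same image is no larger. *)
  suff [l [y [yk yD gty ltl yle]]] : exists l y, [/\ tpart w y.2 = k, mdeg (xmon y) = D,
      gt z y, (xmon z l < xmon z' l)%N & (xmon y <= xmon z + U_(l))%MM].
    have [z'' [sz'' z''E z''y]] := standard_exists y.
    have [z''x z''t] : xmon z'' = xmon y /\ tpart w z''.2 = tpart w y.2 by rewrite z''E; case: z''E.
    exists l, z''; rewrite z''x; split=> //; first by rewrite /P z''x z''t.
    by case: z''y => [->//|]; apply: xy_gt_trans.
  case/orP: gt_zz' => [gt2 | /andP[/eqP z2E /lex_gtP[p [zp zeq]]]].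
    have [|l [h [b [ltl gtb bk lE]]]] := standard_exchange sz _ gt2; first by rewrite zk.
    (* Degrees in [lE] give [|h| = 1 + d (|z.2| - |b|)], where [|b| <= |z.2|]. So some variable
       [x_p] can be cancelled to return to degree [D]. *)
    have hx0 : (0 < mdeg (h + z.1))%N.
      have := congr1 (@mdeg n) lE; rewrite !mdegD mdeg1.
      have := degE (0%MM, b); have := degE (0%MM, z.2); rewrite /= !add0m mdeg0 bk.
      have := leq_mul (leqnn d) (rlex_gt_mdeg gtb); lia.
    have [p hp] : exists p, (h + z.1)%MM p != 0%N.
      have : (h + z.1)%MM != 0%MM by rewrite -mdeg_eq0 -lt0n.
      by case/mnm_neqP => p; rewrite mnm0E; exists p.
    have hpU : (U_(p) <= h + z.1)%MM by rewrite lep1mP.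
    have yE : (xmon ((h + z.1 - U_(p))%MM, b) + U_(p) = xmon z + U_(l))%MM.
      apply/mnmP=> j; have := (mnmP _ _).1 lE j; have := mnm_lepP hpU j.
      by rewrite /= !mnmDE !mnmBE !mnmDE; lia.
    exists l, ((h + z.1 - U_(p))%MM, b); split=> //.
    - by rewrite bk.
    - by have := congr1 (@mdeg n) yE; rewrite mdegD (mdegD (xmon z)) !mdeg1 zD => /addIn.
    - by rewrite /xy_gt gtb.
    - by rewrite -yE lem_addr.
  (* Equal [y]-parts: [p] is the first index where [z.1] and [z'.1] differ, and [z.1] is larger
     there. As their degrees agree, [z'.1] is larger at some later [l]; trading [x_p] for [x_l]
     keeps the degree and goes down lexicographically. *)
  have z1D : mdeg z.1 = mdeg z'.1.
    by move: zD; rewrite -z'D /= !mdegD z2E => /addIn.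
  have /forallPn[l] : ~~ [forall l, z'.1 l <= z.1 l]%N.
    apply/negP=> z'z; move: zp.
    by rewrite (eq_mdeg_le (z'z : (z'.1 <= z.1)%MM)) ?ltnn // z1D.
  rewrite -ltnNge => zl.
  have lp : (p < l)%N.
    rewrite ltnNge leq_eqVlt; apply/negP=> /orP[/eqP/val_inj lp|/zeq zz'].
      by move: zl; rewrite lp ltnNge (ltnW zp).
    by rewrite zz' ltnn in zl.
  have pU : (U_(p) <= z.1 + U_(l))%MM by rewrite lep1mP mnmDE; lia.
  have yE : (xmon ((z.1 + U_(l) - U_(p))%MM, z.2) + U_(p) = xmon z + U_(l))%MM.
    apply/mnmP=> j; have := mnm_lepP pU j.
    by rewrite /= !mnmDE !mnmBE !mnmDE; lia.
  exists l, ((z.1 + U_(l) - U_(p))%MM, z.2); split=> //.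
  + by have := congr1 (@mdeg n) yE; rewrite mdegD (mdegD (xmon z)) !mdeg1 zD => /addIn.
  + rewrite /xy_gt /= eqxx; apply/orP; right; apply/lex_gtP; exists p.
    have lpF : (l == p) = false by apply/negbTE; rewrite neq_ltn lp orbT.
    rewrite !mnmBE !mnmDE !mnm1E eqxx lpF; split=> [|j jp]; first by lia.
    rewrite !mnmBE !mnmDE !mnm1E (gtn_eqF jp : (p == j) = false).
    by rewrite (gtn_eqF (ltn_trans jp lp) : (l == j) = false) addn0 subn0.
  + by rewrite /= !mnmDE z2E ltn_add2r.
  + by rewrite -yE lem_addr.
have usE u : u \in us <-> Defs.cover F e k u /\ mdeg u = D.
  rewrite usP; split=> [[z [_ zk zD] <-]|[/(cover_decomposition hI hgen)[y yE] uD]].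
    by split=> //; rewrite -zk; apply: (cover_image hI hgen z).
  have [z [sz zE _]] := standard_exists y; rewrite yE in zE.
  have [zx zk] : xmon z = u /\ tpart w z.2 = k by rewrite zE; case: zE.
  by exists z => //; split; rewrite ?zx.
have [p [b [g [M [b0 hg gE kg kM]]]]] : linear_resolution_of_degree (monomial_span (K := K) us) D.
  by apply: linear_exchange_resolution => // u /usE[].
exists p, b, g, M; split=> // f; rewrite -gE.
split; move: f; last first.
  apply: (ideal_gen_sub (ideal_gen_is_ideal _)) => f [u /usE[ku uD] ->].
  apply: ideal_gen_mem; split; last by rewrite dhomogX; apply/eqP.
  by apply/(symbolic_powerE hI)/supp_idealX.
apply: (ideal_gen_sub (ideal_gen_is_ideal _)) => f [/(symbolic_powerE hI) fk fD].
apply/monomial_spanE => u uf; exists u; last exact: lepm_refl.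
by apply/usE; split; [apply: fk | apply: (dhomogP _ _ _ fD)].
Qed.

End StandardMonomials.

Theorem theorem2p2 (K : fieldType) (n r : nat)
    (F : 'I_r -> {set 'I_n}) (e : 'I_r -> nat) (I : {mpoly K[n]} -> Prop)
    (hI : minimal_intersection F e I)
    (hlin : linear_cover_function F e)
    (m : nat) (w : 'I_m -> 'X_{1..n} * nat)
    (hgen : min_monomial_generators (symbolic_rees I) w)
    (hsort : forall i j : 'I_m, (i < j)%N -> tmon_gt (w i) (w j))
    (hx : x_condition (@xy_gt n m) (presentation_ideal (K := K) w)) :
  (forall k : nat, (0 < k)%N -> linear_quotients (symbolic_power I k)) /\
  (forall k : nat, (0 < k)%N -> componentwise_linear (symbolic_power I k)).
Proof.
split=> k _.
  exact: symbolic_power_linear_quotients hI hlin hgen hx k.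
exact: symbolic_power_componentwise_linear hI hlin hgen hx k.
Qed.
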